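(* For any positive integers $d,t,D$ there is a constant $C=C(d,t,D)$ with the following property. Let $\mathcal{P}$ be a hereditary property of graphs, and let $\mathcal{H}$ be the family of minimal forbidden graphs for $\mathcal{P}$. Let $0<\epsilon<1/2$. Within the family $\mathcal{A}$ of semi-algebraic graphs in $\mathbb{R}^d$ with complexity $(t,D)$, the property $\mathcal{P}$ can be $\epsilon$-tested with vertex query complexity at most $(r\,\Psi_2(\mathcal{H},r))^C$, where $r=(1/\epsilon)^C$.
   Context: A graph $(P,E)$ with finite vertex set $P=\{p_1,\dots,p_n\}\subset\mathbb{R}^d$ and symmetric edge relation $E$ is semi-algebraic in $\mathbb{R}^d$ with complexity $(t,D)$ if there are polynomials $f_1,\dots,f_t\in\mathbb{R}[x_1,\dots,x_{2d}]$ (viewed as functions of two points of $\mathbb{R}^d$) and a Boolean function $\Phi$ such that for every $1\le i<j\le n$: $(p_i,p_j)\in E$ if and only if $\Phi(f_1(u,v)\ge0,\dots,f_t(u,v)\ge0)=1$ for both $(u,v)=(p_i,p_j)$ and $(u,v)=(p_j,p_i)$; and, for every $1\le l\le t$ and any fixed $q\in\mathbb{R}^d$, the $d$-variate polynomials $f_l(\mathbf{x},q)$ and $f_l(q,\mathbf{x})$ have degree at most $D$. A property is a family of graphs closed under isomorphism; it is hereditary if it is closed under taking induced subgraphs. $\mathcal{H}$ consists of all graphs $H\notin\mathcal{P}$ such that every proper induced subgraph of $H$ is in $\mathcal{P}$. For a graph $H$ and a graph $R$ with loops (allowed), $H\to_{\mathrm{ind}}R$ means there is a map $f:V(H)\to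 V(R)$ which maps edges of $H$ to edges of $R$ and maps every nonadjacent pair of distinct vertices of $H$ to a nonadjacent pair in $R$ (if two vertices are mapped to the same vertex $i$, adjacency of the image pair means that there is a loop at $i$). For $r\ge0$, $\mathcal{H}_r$ is the family of such graphs $R$ on at most $r$ vertices for which there is at least one $H\in\mathcal{H}$ with $H\to_{\mathrm{ind}}R$. If $\mathcal{H}_r\ne\emptyset$, $$\Psi_2(\mathcal{H},r)=\max_{R\in\mathcal{H}_r}\ \min_{H\in\mathcal{H}:\,H\to_{\mathrm{ind}}R}|V(H)| ,$$ and $\Psi_2(\mathcal{H},r)=1$ if $\mathcal{H}_r=\emptyset$. A graph $G$ is $\epsilon$-far from satisfying $\mathcal{P}$ if one must change the adjacency relation of at least an $\epsilon$ fraction of all pairs of vertices to turn $G$ into a graph satisfying $\mathcal{P}$. $\mathcal{P}$ can be $\epsilon$-tested within $\mathcal{A}$ if there is a randomized algorithm ($\epsilon$-tester) which, given the number of vertices and the ability to query whether a given pair of vertices is an edge, distinguishes with probability at least $2/3$ between the cases that $G$ satisfies $\mathcal{P}$ and that $G$ is $\epsilon$-far from satisfying $\mathcal{P}$, for every $G\in\mathcal{A}$. The vertex query complexity is the number of vertices that are randomly sampled. *)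

(* Defs.v *)
(* mpoly comes first because it shadows ssrbool's symmetric. *)
From mathcomp Require Import mpoly.
From mathcomp Require Import all_boot all_order all_algebra.
From mathcomp Require Import boolp classical_sets reals.

Set Implicit Arguments.
Unset Strict Implicit.
Unset Printing Implicit Defensive.

Import Order.TTheory GRing.Theory Num.Theory.
Local Open Scope ring_scope.

Record simple_graph (V : finType) := SimpleGraph {
  adj :> rel V;
  adj_sym : symmetric adj;
  adj_irrefl : irreflexive adj
}.

Record loop_graph (V : finType) := LoopGraph {
  ladj :> rel V;
  ladj_sym : symmetric ladj
}.

Definition graph_family := forall V : finType, simple_graph V -> Prop.

Definition isomorphic (V W : finType) (G : simple_graph V)
    (H : simple_graph W) : Prop :=
  exists f : V -> W, bijective f /\ forall u v, H (f u) (f v) = G u v.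

Section Induced.
Variables (V : finType) (G : simple_graph V) (S : {set V}).

Definition induced_adj : rel {x : V | x \in S} := fun u v => G (val u) (val v).

Lemma induced_adj_sym : symmetric induced_adj.
Proof. by move=> u v; apply: adj_sym. Qed.

Lemma induced_adj_irrefl : irreflexive induced_adj.
Proof. by move=> u; apply: adj_irrefl. Qed.

Definition induced := SimpleGraph induced_adj_sym induced_adj_irrefl.
End Induced.

Definition iso_closed (P : graph_family) : Prop :=
  forall (V W : finType) (G : simple_graph V) (H : simple_graph W),
    isomorphic G H -> P _ G -> P _ H.

Definition hereditary (P : graph_family) : Prop :=
  iso_closed P /\
  forall (V : finType) (G : simple_graph V) (S : {set V}),
    P _ G -> P _ (induced G S).

Definition minimal_forbidden (P : graph_family) : graph_family :=
  fun V H => ~ P _ H /\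
    forall S : {set V}, S \proper [set: V] -> P _ (induced H S).

Definition ind_hom (V W : finType) (H : simple_graph V) (R : loop_graph W)
    : Prop :=
  exists f : V -> W,
    (forall u v, H u v -> R (f u) (f v)) /\
    (forall u v, u != v -> ~~ H u v -> ~~ R (f u) (f v)).

(* The default value 0 is returned when there is no least, resp. greatest,
   element; see min_order_attained and max_min_order_attained below. *)
Definition min_nat (A : nat -> Prop) : nat :=
  xget 0%N (fun m => A m /\ forall k, A k -> (m <= k)%N).

Definition max_nat (A : nat -> Prop) : nat :=
  xget 0%N (fun m => A m /\ forall k, A k -> (k <= m)%N).

Section Psi.
Variables (F : graph_family) (K : realType) (r : K).

Definition maps_to (W : finType) (R : loop_graph W) (m : nat) : Prop :=
  exists (V : finType) (H : simple_graph V),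
    [/\ F H, ind_hom H R & #|V| = m].

Definition in_Hr (W : finType) (R : loop_graph W) : Prop :=
  #|W|%:R <= r /\ exists m, maps_to R m.

Definition min_order (W : finType) (R : loop_graph W) : nat :=
  min_nat (maps_to R).

Definition min_orders (m : nat) : Prop :=
  exists (W : finType) (R : loop_graph W), in_Hr R /\ m = min_order R.

Definition psi2 : nat :=
  if `[< exists (W : finType) (R : loop_graph W), in_Hr R >]
  then max_nat min_orders else 1%N.

Lemma min_order_attained (W : finType) (R : loop_graph W) :
  (exists m, maps_to R m) ->
  maps_to R (min_order R) /\ forall k, maps_to R k -> (min_order R <= k)%N.
Proof.
move=> [m Rm]; rewrite /min_order /min_nat.
apply: (xgetPex 0%N (P := fun m => maps_to R m /\
  forall k, maps_to R k -> (m <= k)%N)).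
have exA : exists n, `[< maps_to R n >] by exists m; apply/asboolP.
case: (ex_minnP exA) => n /asboolP Rn le_n.
by exists n; split=> // k Rk; apply/le_n/asboolP.
Qed.

Lemma max_min_order_attained :
  (exists (W : finType) (R : loop_graph W), in_Hr R) ->
  min_orders (max_nat min_orders) /\
  forall k, min_orders k -> (k <= max_nat min_orders)%N.
Proof.
move=> [W0 [R0 HR0]].
have sym_of k (A : {set 'I_k * 'I_k}) :
    symmetric (fun x y => ((x, y) \in A) || ((y, x) \in A)).
  by move=> x y; rewrite orbC.
pose lg k A := LoopGraph (@sym_of k A).
pose M := \max_(k < (Num.truncn r).+1) \max_(A : {set 'I_k * 'I_k})
  min_order (lg k A).
have bounded m : min_orders m -> (m <= M)%N.
  case=> W [R [[le_r _] ->]].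
  have ltW : (#|W| < (Num.truncn r).+1)%N.
    by rewrite ltnS truncn_ge_nat// (le_trans _ le_r).
  pose A : {set 'I_#|W| * 'I_#|W|} :=
    [set p | R (enum_val p.1) (enum_val p.2)]%SET.
  have lgE x y : lg _ A x y = R (enum_val x) (enum_val y).
    by rewrite /lg /A /= !inE /= (ladj_sym R (enum_val y)) orbb.
  have -> : min_order R = min_order (lg _ A).
    congr min_nat; apply/funext => n; apply/propext.
    split=> -[V [H [FH [f [f1 f2]] Vn]]]; exists V, H; split=> //.
      exists (fun v => enum_rank (f v)).
      by split=> [u v Huv|u v uv Huv]; rewrite lgE !enum_rankK; auto.
    exists (fun v => enum_val (f v)).
    by split=> [u v Huv|u v uv Huv]; rewrite -lgE; auto.
  apply: leq_trans (leq_bigmax (Ordinal ltW)).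
  exact: (leq_bigmax A).
rewrite /max_nat.
apply: (xgetPex 0%N (P := fun m => min_orders m /\
  forall k, min_orders k -> (k <= m)%N)).
have exA : exists n, `[< min_orders n >].
  by exists (min_order R0); apply/asboolP; exists W0, R0.
have ubA n : `[< min_orders n >] -> (n <= M)%N by move/asboolP/bounded.
case: (ex_maxnP exA ubA) => n /asboolP Rn le_n.
by exists n; split=> // k Rk; apply/le_n/asboolP.
Qed.
End Psi.

Section SemiAlgebraic.
Variables (R : realType) (d : nat).

Definition eval2 (f : {mpoly R[d + d]}) (u v : 'rV[R]_d) : R :=
  f.@[fun i => row_mx u v 0 i].

Definition fix_snd (f : {mpoly R[d + d]}) (q : 'rV[R]_d) : {mpoly R[d]} :=
  f \mPo [tuple match split i with
                | inl j => 'X_j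
                | inr j => (q 0 j)%:MP
                end | i < d + d].

Definition fix_fst (f : {mpoly R[d + d]}) (q : 'rV[R]_d) : {mpoly R[d]} :=
  f \mPo [tuple match split i with
                | inl j => (q 0 j)%:MP
                | inr j => 'X_j
                end | i < d + d].

(* msize is 1 + total degree (0 for the zero polynomial).  The condition on
   pairs is symmetric, so the numbering of the vertices plays no role. *)
Definition semialgebraic (t D : nat) : graph_family := fun V G =>
  exists p : V -> 'rV[R]_d, injective p /\
  exists (f : 'I_t -> {mpoly R[d + d]}) (Phi : {ffun 'I_t -> bool} -> bool),
    (forall u v : V, u != v ->
       (G u v <-> (Phi [ffun l => 0 <= eval2 (f l) (p u) (p v)] /\
                   Phi [ffun l => 0 <= eval2 (f l) (p v) (p u)]))) /\
    (forall (l : 'I_t) (q : 'rV[R]_d),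
       (msize (fix_snd (f l) q) <= D.+1)%N /\
       (msize (fix_fst (f l) q) <= D.+1)%N).
End SemiAlgebraic.

Definition changed_pairs (V : finType) (G G' : simple_graph V)
    : {set {set V}} :=
  [set [set p.1; p.2]%SET | p : V * V & G p.1 p.2 != G' p.1 p.2]%SET.

(* When there are no pairs of vertices the fraction is 0 / 0 = 0 < eps, so a
   graph on at most one vertex that satisfies P is not far from P. *)
Definition eps_far (R : realType) (P : graph_family) (eps : R) (V : finType)
    (G : simple_graph V) : Prop :=
  forall G' : simple_graph V, P _ G' ->
    eps <= #|changed_pairs G G'|%:R / 'C(#|V|, 2)%:R.

(* Randomized adaptive algorithms on k vertices that may toss fair coins and
   query pairs. *)
Inductive query_alg (k : nat) : Type :=
| Output of bool
| Query of 'I_k & 'I_k & (bool -> query_alg k)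
| Toss of (bool -> query_alg k).

Fixpoint accept_prob (R : realType) (k : nat) (e : rel 'I_k)
    (a : query_alg k) : R :=
  match a with
  | Output b => b%:R
  | Query i j next => accept_prob R e (next (e i j))
  | Toss next =>
      (accept_prob R e (next true) + accept_prob R e (next false)) / 2
  end.

(* On an n-vertex graph the tester samples sample_size n distinct vertices
   uniformly at random, then runs an algorithm (depending on n) which queries
   pairs of sampled vertices, addressed by their position in the sample. *)
Record tester := Tester {
  sample_size : nat -> nat;
  sample_size_le : forall n, (sample_size n <= n)%N;
  decide : forall n, query_alg (sample_size n)
}.

Definition samples (k : nat) (V : finType) : {set {ffun 'I_k -> V}} :=
  [set s : {ffun 'I_k -> V} | injectiveb s]%SET.

Definition tester_accept_prob (R : realType) (T : tester) (V : finType)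
    (G : simple_graph V) : R :=
  let S := samples (sample_size T #|V|) V in
  (\sum_(s in S) accept_prob R (fun i j => G (s i) (s j)) (decide T #|V|))
    / #|S|%:R.

Definition is_eps_tester (R : realType) (A P : graph_family) (eps : R)
    (T : tester) : Prop :=
  forall (V : finType) (G : simple_graph V), A _ G ->
    (P _ G -> 2 / 3 <= tester_accept_prob R T G) /\
    (eps_far P eps G -> 2 / 3 <= 1 - tester_accept_prob R T G).

Definition testable_within (R : realType) (A P : graph_family) (eps : R)
    (bound : R) : Prop :=
  exists T : tester,
    (forall n, (sample_size T n)%:R <= bound) /\ is_eps_tester A P eps T.

(* Main.v *)
Require Import Defs.
From mathcomp Require Import boolp classical_sets reals.
From mathcomp Require Import all_boot all_order all_algebra.
From mathcomp Require mpoly.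
From mathcomp Require Import zify ring lra.

Set Implicit Arguments.
Unset Strict Implicit.
Unset Printing Implicit Defensive.

Import Order.TTheory GRing.Theory Num.Theory.
Local Open Scope ring_scope.

(** Adjacency in a semi-algebraic graph depends on the signs of boundedly many
    linear functionals of bounded dimension, applied to the vector of monomials
    of a vertex ([dot_coefficients]).  Such sign conditions admit cuttings: for
    every N the vertices fall into (c N)^c classes, and for each class at most a fraction
    1/N of the vertices is adjacent to some but not all of that class
    ([cutting], [semialgebraic_cuttable]).  This property, [cuttable], is all
    that the rest of the argument knows about semi-algebraic graphs, and it has
    two consequences.

    First, polynomial Ramsey numbers: a class of a cutting together with the
    vertices that see it constantly gives two linear-size sets joined completely
    or not at all, and iterating this yields, in every vertex set of size s^e,
    a clique or an independent set of size s ([large_homogeneous_set]).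

    Second, a model of the graph on r = (1/eps)^O(1) classes
    ([homogeneous_model]).  A coarse cutting gives the classes, and inside each
    class a cell of a much finer cutting, chosen at random, gives a core with a
    fraction 1/(1/eps)^O(1) of the vertices.  With positive probability any two
    distinct cores are joined completely or not at all, and joining whole
    classes in the way their cores are joined changes few pairs.

    The tester accepts when the sampled vertices induce a graph with the property
    P, so it always accepts graphs in P.  On a graph that is far from P, a sample
    of size polynomial in r and Psi meets every core in Psi^e vertices with high
    probability ([samples_hit]), hence contains a homogeneous set of size Psi
    in every core.  Put a loop at a class when this set is a clique, and obtain
    a graph R with loops on at most r vertices.  If no minimal forbidden graph
    maps to R, then the blow-up of R has P and differs from the given graph in
    few pairs, which contradicts farness.  Otherwise some forbidden H with at
    most Psi vertices maps to R, and the homogeneous sets contain a copy of H, so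
    the sample is rejected ([far_sample_rejected]). *)

(** * Cells of hyperplane arrangements *)

Section Cells.
Variable R : realFieldType.
Implicit Types (a b c : R) (x y z : nat -> R) (m : nat) (I S : seq (nat -> R)).

Definition sign_pair a : bool * bool := (0 <= a, a <= 0).

Definition dot m x y := \sum_(i < m) x i * y i.

(** The functional that compares, over the first m coordinates, the values of
    coordinate m at which y and z vanish (see [dot_eliminate]), or y itself when it
    ignores coordinate m.  This is one step of Fourier-Motzkin elimination. *)
Definition eliminate m y z : nat -> R :=
  fun i => if y m == 0 then y i else y i / y m - z i / z m.

Definition eliminations m I := [seq eliminate m y z | y <- I, z <- I].

(** The signs at x of the functionals of I and of all their iterated
    eliminations.  Equality of codes puts two points in the same cell of the
    arrangement refined by its vertical walls, whose cells, unlike those of the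
    arrangement itself, are determined by boundedly many functionals. *)
Fixpoint cell_code m I x : seq (bool * bool) :=
  if m is m'.+1
  then [seq sign_pair (dot m y x) | y <- I] ++ cell_code m' (eliminations m' I) x
  else [::].

Fixpoint certificate_size m : nat :=
  if m is m'.+1 then (2 * certificate_size m' + 2)%N else 0%N.

Fixpoint code_size m k : nat :=
  if m is m'.+1 then (k + code_size m' (k * k))%N else 0%N.

Lemma size_cell_code m I x : size (cell_code m I x) = code_size m (size I).
Proof.
elim: m I => //= m IH I.
by rewrite size_cat size_map IH size_allpairs.
Qed.

Lemma cell_code_eqP m I x z :
  cell_code m.+1 I x = cell_code m.+1 I z <->
  (forall y, y \in I -> sign_pair (dot m.+1 y x) = sign_pair (dot m.+1 y z)) /\
  cell_code m (eliminations m I) x = cell_code m (eliminations m I) z.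
Proof.
split=> [/= /eqP|[eqI eq_rest]] /=.
  rewrite eqseq_cat ?size_map// => /andP[/eqP eqI /eqP ->]; split=> //.
  exact/eq_in_map.
by rewrite eq_rest; congr cat; apply/eq_in_map.
Qed.

Lemma cell_code_sub m I I' x z :
  {subset I <= I'} -> cell_code m I' x = cell_code m I' z ->
  cell_code m I x = cell_code m I z.
Proof.
elim: m I I' => // m IH I I' sII' /cell_code_eqP[eqI' eq_rest].
apply/cell_code_eqP; split=> [y /sII'/eqI' //|].
apply: IH eq_rest => _ /allpairsP[[u v] [/= uI vI ->]].
by apply: allpairs_f; apply: sII'.
Qed.

Lemma sign_pairM c a b :
  sign_pair a = sign_pair b -> sign_pair (c * a) = sign_pair (c * b).
Proof.
case=> ge0 le0; rewrite /sign_pair.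
have [c0|c0|<-] := ltgtP 0 c; last by rewrite !mul0r.
- by rewrite !pmulr_rge0 ?pmulr_rle0// ge0 le0.
- by rewrite !nmulr_rge0 ?nmulr_rle0// ge0 le0.
Qed.

Lemma sign_pairD a a' b b' :
  sign_pair a = sign_pair a' -> sign_pair b = sign_pair b' ->
  0 <= a -> 0 <= b -> sign_pair (a + b) = sign_pair (a' + b').
Proof.
case=> ge0a le0a [ge0b le0b] a0 b0.
have a'0 : 0 <= a' by rewrite -ge0a.
have b'0 : 0 <= b' by rewrite -ge0b.
have le0D (u v : R) : 0 <= u -> 0 <= v -> (u + v <= 0) = (u <= 0) && (v <= 0).
  by move=> u0 v0; apply/idP/andP => [|[]]; [split|]; lra.
by rewrite /sign_pair !addr_ge0// !le0D// le0a le0b.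
Qed.

Lemma sign_pairN a b :
  sign_pair a = sign_pair b -> sign_pair (- a) = sign_pair (- b).
Proof. by move=> ab; rewrite -mulN1r -[- b]mulN1r; apply: sign_pairM. Qed.

(** The value of coordinate m at which y vanishes on the vertical line through
    x. *)
Definition height m y x := - dot m y x / y m.

Lemma dot_height m y x : y m != 0 ->
  dot m.+1 y x = y m * (x m - height m y x).
Proof.
move=> ym; rewrite /dot big_ord_recr /= -/(dot m y x) /height.
by field.
Qed.

Lemma dot_eliminate m y z x : y m != 0 ->
  dot m (eliminate m y z) x = height m z x - height m y x.
Proof.
move=> ym; rewrite /height /dot /eliminate (negbTE ym).
rewrite !mulNr opprK addrC !mulr_suml -sumrB.
by apply: eq_bigr => i _; ring.
Qed.

(** The maximiser comes as a list of length at most one, so that an empty s does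
    not need separate treatment. *)
Lemma exists_argmax (T : eqType) (s : seq T) (g : T -> R) :
  exists t, [/\ {subset t <= s}, (size t <= 1)%N &
    forall u, u \in s -> exists2 v, v \in t & g u <= g v].
Proof.
elim: s => [|u s [t [ts tsz tmax]]]; first by exists [::].
case: t ts tsz tmax => [|v [|//]] ts _ tmax.
  exists [:: u]; split=> // [v|v].
    by rewrite !inE => ->.
  by rewrite inE => /predU1P[->|/tmax[]//]; exists u; rewrite ?inE.
have vs : v \in s by apply: ts; rewrite inE.
have vmax w : w \in s -> g w <= g v.
  by move=> /tmax[? ]; rewrite inE => /eqP ->.
have [uv|/ltW vu] := lerP (g u) (g v).
  exists [:: v]; split=> // [w|w].
    by rewrite !inE => /eqP ->; rewrite vs orbT.
  by rewrite inE => /predU1P[->|/vmax ?]; exists v; rewrite ?inE.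
exists [:: u]; split=> // [w|w].
  by rewrite !inE => ->.
rewrite inE => /predU1P[->|/vmax ?]; exists u; rewrite ?inE//.
exact: le_trans vu.
Qed.

Lemma eliminations_cover m S I' :
  {subset I' <= eliminations m S} ->
  exists I, [/\ {subset I <= S}, (size I <= 2 * size I')%N &
    {subset I' <= eliminations m I}].
Proof.
elim: I' => [|f I' IH] sI'; first by exists [::].
have [I [IS szI I'I]] : exists I, [/\ {subset I <= S}, (size I <= 2 * size I')%N &
    {subset I' <= eliminations m I}].
  by apply: IH => g gI'; apply: sI'; rewrite inE gI' orbT.
have /allpairsP[[y z] [/= yS zS ->]] : f \in eliminations m S.
  by apply: sI'; rewrite mem_head.
exists [:: y, z & I]; split=> /=.
- by move=> u; rewrite !inE => /or3P[/eqP ->|/eqP ->|/IS].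
- by rewrite mulnS; lia.
- move=> g; rewrite inE => /predU1P[->|/I'I /allpairsP[[u v] [/= uI vI ->]]].
    by apply: allpairs_f; rewrite !inE eqxx ?orbT.
  by apply: allpairs_f; rewrite !inE ?uI ?vI !orbT.
Qed.

(** Among the functionals of S whose zero lies below, respectively above, the last
    coordinate of x, the nearest ones bound x from both sides.  The order of the
    zeros over the first m coordinates is the sign of eliminations, for which the
    induction hypothesis supplies a certificate; so the two nearest functionals
    and the parents of that certificate determine all signs on S. *)
Lemma cell_certificate m S x :
  exists I, [/\ {subset I <= S}, (size I <= certificate_size m)%N &
    forall z, cell_code m I z = cell_code m I x ->
    forall y, y \in S -> sign_pair (dot m y z) = sign_pair (dot m y x)].
Proof.
elim: m S => [|m IH] S.
  exists [::]; split=> // z _ y _; by rewrite /dot !big_ord0.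
have [I' [I'S szI' I'P]] := IH (eliminations m S).
have [I [IS szI I'I]] := eliminations_cover I'S.
pose below := [seq y <- S | (y m != 0) && (height m y x <= x m)].
pose above := [seq y <- S | (y m != 0) && (x m <= height m y x)].
have [lo [loS szlo lomax]] := exists_argmax below (fun y => height m y x).
have [hi [hiS szhi himin]] := exists_argmax above (fun y => - height m y x).
exists (lo ++ hi ++ I); split.
- move=> y; rewrite !mem_cat => /or3P[/loS|/hiS|/IS//].
    by rewrite mem_filter => /andP[].
  by rewrite mem_filter => /andP[].
- rewrite !size_cat; apply: leq_trans (leq_add szlo (leq_add szhi szI)) _.
  by rewrite addnA addnC leq_add2r leq_pmul2l.
move=> z /cell_code_eqP[codeI code_rest] y yS.
have sign_elim f : f \in eliminations m S ->
    sign_pair (dot m f z) = sign_pair (dot m f x).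
  apply: I'P; apply: cell_code_sub code_rest => f' /I'I.
  move=> /allpairsP[[u v] [/= uI vI ->]].
  by apply: allpairs_f; rewrite !mem_cat ?uI ?vI !orbT.
have [ym|ym] := eqVneq (y m) 0.
  have := sign_elim _ (allpairs_f (eliminate m) yS yS).
  have -> : eliminate m y y = y.
    by apply/funext => i; rewrite /eliminate ym eqxx.
  by rewrite /dot !big_ord_recr /= ym !mul0r !addr0.
rewrite !dot_height//; apply: sign_pairM.
have sign_height u v : u \in S -> v \in S -> u m != 0 ->
    sign_pair (height m v z - height m u z) =
    sign_pair (height m v x - height m u x).
  move=> uS vS um; rewrite -!dot_eliminate//.
  exact/sign_elim/allpairs_f.
have sign_guard v : v \in lo ++ hi -> v m != 0 ->
    sign_pair (z m - height m v z) = sign_pair (x m - height m v x).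
  move=> vI vm; have := codeI v; rewrite catA mem_cat vI => /(_ isT).
  rewrite !dot_height// => /(sign_pairM (v m)^-1).
  by rewrite !mulKf.
have [yx|/ltW xy] := lerP (height m y x) (x m).
  have [|v vlo yv] := lomax y; first by rewrite mem_filter ym yx.
  have := loS v vlo; rewrite mem_filter => /andP[/andP[vm vx] vS].
  rewrite (_ : z m - _ = (z m - height m v z) + (height m v z - height m y z));
    last by ring.
  rewrite (_ : x m - _ = (x m - height m v x) + (height m v x - height m y x));
    last by ring.
  apply/esym/sign_pairD; rewrite ?subr_ge0//.
    by apply/esym/sign_guard => //; rewrite mem_cat vlo.
  exact/esym/sign_height.
have [|v vhi yv] := himin y; first by rewrite mem_filter ym xy.
have := hiS v vhi; rewrite mem_filter => /andP[/andP[vm vx] vS].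
rewrite -[z m - _]opprK -[x m - _]opprK; apply: sign_pairN.
rewrite (_ : - (z m - _) = (height m v z - z m) + (height m y z - height m v z));
  last by ring.
rewrite (_ : - (x m - _) = (height m v x - x m) + (height m y x - height m v x));
  last by ring.
apply/esym/sign_pairD; rewrite ?subr_ge0 -1?[_ <= height m y x]lerN2//.
  rewrite -[_ - x m]opprB -[_ - z m]opprB; apply/esym/sign_pairN/sign_guard => //.
  by rewrite mem_cat vhi orbT.
exact/esym/sign_height.
Qed.

End Cells.

(** * Random sampling of hyperplanes *)

Lemma leq_expl e m n : (m <= n)%N -> (m ^ e <= n ^ e)%N.
Proof. by case: e => // e; rewrite leq_exp2r. Qed.

Lemma expn_succ_ge n k : (n ^ k.+1 + k.+1 * n ^ k <= n.+1 ^ k.+1)%N.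
Proof.
elim: k => [|k IH]; first by rewrite !expn1 expn0 muln1 addn1.
rewrite [(n.+1 ^ _)%N]expnS.
apply: leq_trans (leq_mul (leqnn n.+1) IH).
by rewrite !(expnS n); nia.
Qed.

Lemma double_pred_expn n m : (0 < n)%N -> (2 ^ m * n.-1 ^ (n * m) <= n ^ (n * m))%N.
Proof.
case: n => // n _ /=.
rewrite !expnM -expnMn leq_expl//.
by apply: leq_trans (expn_succ_ge n n); rewrite !expnS; nia.
Qed.

(** For a random f, the chance that Z f has density more than 1/N and yet is missed by
    all values of f is at most (1 - 1/N)^(k - |T|): fix f on T, which fixes Z f,
    and the other k - |T| values are still independent. *)
Lemma count_avoiding (W : finType) (k N : nat) (T : {set 'I_k})
    (Z : {ffun 'I_k -> W} -> {set W}) :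
  (0 < N)%N ->
  (forall f g : {ffun 'I_k -> W}, {in T, f =1 g} -> Z f = Z g) ->
  (N ^ (k - #|T|) *
     #|[set f : {ffun 'I_k -> W} |
        (#|W| < N * #|Z f|) && [forall l, f l \notin Z f]]|
   <= #|W| ^ k * N.-1 ^ (k - #|T|))%N.
Proof.
move=> N0 ZT; set bad := finset _.
have [->|[f0]] := set_0Vmem bad; first by rewrite cards0 muln0.
rewrite inE => /andP[heavy0 _].
have [w0 _] : exists w0, w0 \in Z f0.
  apply/set0Pn; apply: contraTneq heavy0 => ->.
  by rewrite cards0 muln0.
pose rho (f : {ffun 'I_k -> W}) : {ffun 'I_k -> W} := [ffun l => if l \in T then f l else w0].
have Zrho f : Z (rho f) = Z f.
  by apply: ZT => l lT; rewrite ffunE lT.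
have rho_on f : f \in bad -> rho f \in pffun_on w0 (mem T) predT.
  move=> _; apply/pffun_onP; split=> [|l _ //].
  by apply/subsetP => l; rewrite inE ffunE; case: ifP => // _ /eqP.
rewrite -[#|bad|]sum1_card (partition_big rho [in pffun_on w0 (mem T) predT])//=.
rewrite big_distrr /=.
have card_on : #|pffun_on w0 (mem T) (predT : pred W)| = (#|W| ^ #|T|)%N.
  by rewrite card_pffun_on.
apply: (@leq_trans (\sum_(h in pffun_on w0 (mem T) (predT : pred W))
    (N.-1 * #|W|) ^ (k - #|T|))%N); last first.
  rewrite sum_nat_const card_on expnMn [(N.-1 ^ _ * _)%N]mulnC mulnA -expnD.
  by rewrite subnKC// -[leqRHS]card_ord max_card.
apply: leq_sum => h _.
rewrite sum1dep_card.
have [heavy|light] := ltnP #|W| (N * #|Z h|); last first.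
  rewrite (_ : [set _ | _] = set0) ?cards0 ?muln0//.
  apply/setP => f; rewrite !inE; apply/negP => /andP[/andP[fh _] /eqP rfh].
  by move: fh; rewrite -Zrho rfh ltnNge light.
pose F l : pred W := if l \in T then pred1 (h l) else mem (~: Z h).
apply: (@leq_trans (N ^ (k - #|T|) * #|family F|)%N).
  rewrite leq_mul2l; apply/orP; right; apply/subset_leq_card/subsetP => f.
  rewrite !inE => /andP[/andP[_ /forallP favoid] /eqP rfh].
  apply/familyP => l; rewrite /F; case: ifP => lT; rewrite inE.
    by rewrite -rfh ffunE lT.
  by rewrite -rfh Zrho favoid.
rewrite card_family foldrE big_image /=.
have -> : (\prod_l #|F l| = #|~: Z h| ^ (k - #|T|))%N.
  rewrite (bigID (mem T)) /= big1 => [|l lT]; last by rewrite /F lT card1.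
  rewrite mul1n (eq_bigr (fun _ => #|~: Z h|)) => [|l lT]; last first.
    by rewrite /F (negbTE lT).
  rewrite prod_nat_const; congr expn.
  have := congr1 (subn^~ #|T|) (cardC (mem T)).
  by rewrite addKn card_ord.
rewrite -expnMn leq_expl// cardsCs setCK mulnBr.
by move: heavy N0; case: N {F Zrho rho_on ZT bad heavy0} => // N; rewrite mulSn /=; lia.
Qed.

(** The exponential wins in the form needed for the union bound of [cutting],
    with one m for all N. *)
Lemma poly_lt_exp a b : exists m, forall N, (0 < N)%N ->
  ((m + a) ^ a * b * N ^ (2 * a) < 2 ^ (m * N))%N.
Proof.
(* Powers of 4 dominate squares, and i ^ 2 exceeds the required exponent. *)
pose i := (4 * a + b + 2)%N; exists (2 ^ (2 * i))%N => N N0.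
have lt2 n : (n < 2 ^ n)%N by apply: ltn_expl.
have exp_ge : ((2 * i + a) * a + b + 2 * a <= 2 ^ (2 * i))%N.
  have -> : (2 ^ (2 * i) = 2 ^ i * 2 ^ i)%N by rewrite mul2n -addnn expnD.
  apply: leq_trans (leq_mul (ltnW (lt2 i)) (ltnW (lt2 i))).
  by rewrite /i; nia.
have base_le : (2 ^ (2 * i) + a <= 2 ^ (2 * i + a))%N.
  rewrite expnD; have := lt2 a; have := expn_gt0 2 (2 * i).
  by set u := (2 ^ (2 * i))%N; set v := (2 ^ a)%N => /=; nia.
apply: (@leq_trans (2 ^ ((2 * i + a) * a) * 2 ^ b * 2 ^ (2 * a * N))%N).
  have pow_le : ((2 ^ (2 * i) + a) ^ a <= 2 ^ ((2 * i + a) * a))%N.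
    by rewrite (expnM 2 (2 * i + a)) leq_expl.
  have N_le : (N ^ (2 * a) <= 2 ^ (2 * a * N))%N.
    by rewrite (mulnC (2 * a)%N N) (expnM 2 N) leq_expl// ltnW.
  apply: (@leq_ltn_trans (2 ^ ((2 * i + a) * a) * b * 2 ^ (2 * a * N))%N).
    by rewrite !leq_mul.
  by rewrite ltn_pmul2r ?expn_gt0// ltn_pmul2l ?expn_gt0.
rewrite -!expnD leq_exp2l//.
apply: leq_trans (leq_mul exp_ge (leqnn N)).
by move: ((2 * i + a) * a)%N => u; nia.
Qed.

Lemma leq_card_bigcup (I T : finType) (A : I -> {set T}) (P : pred I) :
  (#|\bigcup_(i | P i) A i| <= \sum_(i | P i) #|A i|)%N.
Proof.
elim/big_rec2: _ => [|i n B _ le_n]; first by rewrite cards0.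
by apply: leq_trans (leq_card_setU _ _) _; rewrite leq_add2l.
Qed.

Lemma avoid_all (I T : finType) (bad : I -> {set T}) :
  (\sum_i #|bad i| < #|T|)%N -> exists t, forall i, t \notin bad i.
Proof.
move=> lt_sum; suff /set0Pn[t] : (~: \bigcup_i bad i) != set0.
  rewrite inE => tB; exists t => i.
  by apply: contra tB => tbad; apply/bigcupP; exists i.
rewrite -card_gt0 cardsCs setCK subn_gt0.
exact: leq_ltn_trans (leq_card_bigcup _ _) lt_sum.
Qed.

(** In geometric terms, the hyperplane u crosses the cell i of the partition kap. *)
Definition separates (V : finType) (W : Type) (L T : eqType) (e : V -> W -> T)
  (kap : V -> L) (i : L) (u : W) :=
  [exists a, exists b, [&& kap a == i, kap b == i & e a u != e b u]].

(** Sample k = O(N^2) functionals.  A cell determined by K of them and crossed by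
    more than a fraction 1/N of all functionals survives uncrossed by the sample
    with probability at most 2^-(m0 N) by [count_avoiding], and there are only
    k^K 4^len such cells; so some sample leaves no such cell.  By
    [cell_certificate] every point lies in an uncrossed cell determined by K
    sampled functionals, and this cell is its class. *)
Lemma cutting (R : realFieldType) (m : nat) : exists2 c, (0 < c)%N &
  forall (V W : finType) (x : V -> nat -> R) (y : W -> nat -> R) (N : nat),
  (0 < N)%N -> exists (L : finType) (kap : V -> L), (#|L| <= (c * N) ^ c)%N /\
  forall i, (N * #|[set u | separates (fun a u => sign_pair (dot m (y u) (x a)))
                             kap i u]| <= #|W|)%N.
Proof.
pose K := certificate_size m; pose len := code_size m K.
have [m0 m0P] := poly_lt_exp K (4 ^ len).
exists ((m0 + K) ^ K * 4 ^ len + 2 * K + 1)%N; first by rewrite addn1.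
move=> V W x y N N0.
set c1 := (_ + 1)%N.
pose k := (N * (m0 * N) + K)%N.
have k0 : (0 < k)%N.
  have := m0P 1%N isT; rewrite /k addn_gt0 !muln_gt0 N0 andbT /=.
  have [->|_] := posnP K; last by rewrite orbT.
  have [->|//] := posnP m0.
  by rewrite exp1n muln1 expn0 mul1n mul0n expn0 ltnS leqn0 expn_eq0.
have [W0|W_gt0] := posnP #|W|.
  exists unit, (fun=> tt); split=> [|i].
    by rewrite card_unit expn_gt0 muln_gt0 N0 /c1 addn1.
  have := max_card [set u | separates (fun a u => sign_pair (dot m (y u) (x a)))
    (fun=> tt) i u].
  by rewrite W0 leqn0 => /eqP ->; rewrite muln0.
pose functionals (f : {ffun 'I_k -> W}) (J : {ffun 'I_K -> 'I_k}) :=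
  [seq y (f (J i)) | i <- enum 'I_K].
pose sgn a u := sign_pair (dot m (y u) (x a)).
pose code f J a := cell_code m (functionals f J) (x a).
pose Z J (c : len.-tuple (bool * bool)) f : {set W} := [set u |
  [exists a, exists b, [&& code f J a == c, code f J b == c &
     sgn a u != sgn b u]]].
pose bad J c := [set f : {ffun 'I_k -> W} |
  (#|W| < N * #|Z J c f|)%N && [forall l, f l \notin Z J c f]].
have badP J c : (2 ^ (m0 * N) * #|bad J c| <= #|W| ^ k)%N.
  pose T := [set J i | i in 'I_K].
  have T_le : (#|T| <= K)%N by rewrite -[leqRHS]card_ord leq_imset_card.
  have ZT (f g : {ffun 'I_k -> W}) : {in T, f =1 g} -> Z J c f = Z J c g.
    move=> fg; have eq_fun : functionals f J = functionals g J.
      by apply: eq_map => i; rewrite fg// imset_f.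
    by rewrite /Z /code eq_fun.
  have := count_avoiding N0 ZT; rewrite -/(bad J c).
  set s := (k - #|T|)%N => count.
  have s_ge : (N * (m0 * N) <= s)%N by rewrite /s /k -addnBA// leq_addr.
  have pow_le : (2 ^ (m0 * N) * N.-1 ^ s <= N ^ s)%N.
    rewrite -(subnKC s_ge) !expnD mulnA leq_mul ?double_pred_expn//.
    by rewrite leq_expl// leq_pred.
  rewrite -(leq_pmul2l (_ : 0 < N ^ s)%N) ?expn_gt0 ?N0// mulnCA.
  apply: leq_trans (leq_mul (leqnn _) count) _.
  by rewrite mulnCA mulnC leq_mul.
pose label : finType := ({ffun 'I_K -> 'I_k} * len.-tuple (bool * bool))%type.
have Lcard : #|label| = (k ^ K * 4 ^ len)%N.
  by rewrite card_prod card_ffun !card_ord card_tuple card_prod card_bool.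
have k_le : (k <= (m0 + K) * N ^ 2)%N by rewrite /k; nia.
have L_le : (k ^ K * 4 ^ len <= (m0 + K) ^ K * 4 ^ len * N ^ (2 * K))%N.
  apply: leq_trans (leq_mul (leq_expl K k_le) (leqnn _)) _.
  by rewrite expnMn -expnM mulnAC.
have [f fP] : exists f, forall Jc, f \notin bad Jc.1 Jc.2.
  apply: (avoid_all (bad := fun Jc : label => bad Jc.1 Jc.2)).
  rewrite card_ffun card_ord -(ltn_pmul2l (_ : 0 < 2 ^ (m0 * N))%N) ?expn_gt0//.
  apply: (@leq_ltn_trans (k ^ K * 4 ^ len * #|W| ^ k)%N).
    by rewrite -Lcard big_distrr /= -sum_nat_const leq_sum.
  rewrite ltn_pmul2r ?expn_gt0 ?W_gt0//.
  exact: leq_ltn_trans L_le (m0P N N0).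
have [J JP] : exists J : V -> {ffun 'I_K -> 'I_k}, forall a b,
    code f (J a) b = code f (J a) a -> forall l, sgn b (f l) = sgn a (f l).
  apply: (@fin_all_exists _ _ (fun a (J : {ffun 'I_K -> 'I_k}) => forall b,
    code f J b = code f J a -> forall l, sgn b (f l) = sgn a (f l))) => a.
  have [I [IS szI IP]] := cell_certificate m [seq y (f l) | l <- enum 'I_k] (x a).
  have [J JI] : exists J : 'I_K -> 'I_k, forall i : 'I_K,
      (i < size I)%N -> y (f (J i)) = nth (fun=> 0) I i.
    apply: (@fin_all_exists _ _ (fun (i : 'I_K) (l : 'I_k) =>
      (i < size I)%N -> y (f l) = nth (fun=> 0) I i)) => i.
    have [iI|] := ltnP i (size I); last by exists (Ordinal k0).
    by have /mapP[l _ ->] := IS _ (mem_nth (fun=> 0) iI); exists l.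
  exists (finfun J) => b code_b l.
  apply: (IP (x b)); last by rewrite map_f// mem_enum.
  apply: cell_code_sub code_b => g gI.
  have gK : (index g I < K)%N by rewrite (leq_trans _ szI)// index_mem.
  apply/mapP; exists (Ordinal gK); rewrite ?mem_enum//.
  by rewrite ffunE JI/= ?nth_index// index_mem.
have szcode a : size (code f (J a) a) == len.
  by rewrite size_cell_code size_map size_enum_ord.
exists label, (fun a => (J a, Tuple (szcode a))); split=> [|[J0 c0]].
  rewrite Lcard (leq_trans L_le)//.
  rewrite expnMn leq_mul//; last by rewrite leq_pexp2l// /c1; lia.
  apply: (@leq_trans c1); first by rewrite /c1 -addnA leq_addr.
  by rewrite -[leqLHS]expn1 leq_pexp2l// /c1 addn1.
set X := finset _.
have [->|[u]] := set_0Vmem X; first by rewrite cards0 muln0.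
rewrite inE => /existsP[a0 /existsP[_ /and3P[/eqP[Ja0 ca0] _ _]]].
apply: (@leq_trans (N * #|Z J0 c0 f|)%N).
  rewrite leq_mul2l; apply/orP; right; apply/subset_leq_card/subsetP => v.
  rewrite !inE => /existsP[a /existsP[b /and3P[/eqP[Ja /(congr1 val) ca]]]].
  move=> /eqP[Jb /(congr1 val) cb] ab.
  apply/existsP; exists a; apply/existsP; exists b.
  by rewrite ab -{1}ca -cb /= Ja Jb !eqxx.
have := fP (J0, c0); rewrite inE negb_and -leqNgt => /orP[//|/forallPn[l]].
rewrite negbK inE => /existsP[a /existsP[b /and3P[/eqP ca /eqP cb]]].
move: ca0 => /(congr1 val)/=; rewrite Ja0 => ca0.
by rewrite !(JP a0) ?eqxx// Ja0 ?ca ?cb.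
Qed.

(** * Semi-algebraic graphs *)

(** U is a set of vertices rather than the whole of V so that the property
    restricts to subsets, as the recursion for homogeneous sets requires. *)
Definition cuttable (c : nat) (V : finType) (E : rel V) :=
  forall (U : {set V}) (N : nat), (0 < N)%N ->
  exists (L : finType) (kap : V -> L), (#|L| <= (c * N) ^ c)%N /\
  forall i, (N * #|[set u in U | separates E kap i u]| <= #|U|)%N.

Section Linearization.
Import mpoly.
Variables (R : realType) (d D : nat).

Definition monomial : finType := 'X_{1..d < D.+1}.

(** Functions on monomials, numbered by [enum monomial] to match the indexing of
    [dot] by natural numbers. *)
Definition coordinates (F : monomial -> R) : nat -> R :=
  nth 0 [seq F m | m <- enum monomial].

Lemma dot_coordinates (F G : monomial -> R) :
  dot #|monomial| (coordinates F) (coordinates G) = \sum_m F m * G m.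
Proof.
rewrite /dot /coordinates cardE -[RHS]big_enum.
case: (enum monomial) => [|m0 s]; first by rewrite /= big_ord0 big_nil.
rewrite (big_nth m0) big_mkord; apply: eq_bigr => i _.
by rewrite !(nth_map m0).
Qed.

Definition monomials (v : 'rV[R]_d) : nat -> R :=
  coordinates (fun m => \prod_i v 0 i ^+ bmnm m i).

Definition coefficients (p : {mpoly R[d]}) : nat -> R :=
  coordinates (fun m => p@_(bmnm m)).

Lemma dot_coefficients (p : {mpoly R[d]}) (v : 'rV[R]_d) :
  (msize p <= D.+1)%N ->
  dot #|monomial| (coefficients p) (monomials v) =
  p.@[v 0].
Proof. by move=> szp; rewrite dot_coordinates [RHS](mmapE D.+1). Qed.

Lemma eval2_fix_snd (f : {mpoly R[d + d]}) u q :
  eval2 f u q = (fix_snd f q).@[u 0].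
Proof.
rewrite comp_mpoly_meval /eval2; apply: meval_eq => i.
by rewrite tnth_mktuple mxE; case: (split i) => j; rewrite ?mevalXU ?mevalC.
Qed.

Lemma eval2_fix_fst (f : {mpoly R[d + d]}) u q :
  eval2 f q u = (fix_fst f q).@[u 0].
Proof.
rewrite comp_mpoly_meval /eval2; apply: meval_eq => i.
by rewrite tnth_mktuple mxE; case: (split i) => j; rewrite ?mevalXU ?mevalC.
Qed.
End Linearization.

(** E is the defining predicate of the graph, evaluated on the diagonal as well:
    there it need not be false, but off the diagonal it is adjacency.  Each
    vertex contributes the 2 t functionals by which it acts on other points as
    first and as second argument, hence the factor t * 2 in N. *)
Lemma semialgebraic_cuttable (R : realType) (d t D : nat) : (0 < t)%N ->
  exists2 c, (0 < c)%N & forall (V : finType) (G : simple_graph V),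
  @semialgebraic R d t D V G -> exists E : rel V, [/\ symmetric E,
    forall u v, u != v -> E u v = G u v & cuttable c E].
Proof.
move=> t0; set m := #|monomial d D|.
have [c c0 cutP] := cutting R m.
exists (c * (t * 2))%N; first by rewrite !muln_gt0 c0 t0.
move=> V G [p [p_inj [f [Phi [GE degP]]]]].
pose E u v := Phi [ffun l => 0 <= eval2 (f l) (p u) (p v)] &&
              Phi [ffun l => 0 <= eval2 (f l) (p v) (p u)].
exists E; split=> [u v|u v uv|U N N0].
- exact: andbC.
- by apply/andP/idP => /(GE u v uv).
pose W : finType := ({u : V | u \in U} * 'I_t * bool)%type.
pose y (w : W) : nat -> R := let: (u, l, b) := w in
  coefficients D (if b then fix_snd (f l) (p (val u)) else fix_fst (f l) (p (val u))).
pose x a := monomials D (p a).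
have dotE a u l b : dot m (y (u, l, b)) (x a) =
    if b then eval2 (f l) (p a) (p (val u)) else eval2 (f l) (p (val u)) (p a).
  have [snd_deg fst_deg] := degP l (p (val u)).
  case: b; first by rewrite eval2_fix_snd; apply: dot_coefficients.
  by rewrite eval2_fix_fst; apply: dot_coefficients.
have [|L [kap [Lle kapP]]] := cutP V W x y (N * (t * 2))%N.
  by rewrite !muln_gt0 N0 t0.
exists L, kap; split=> [|i].
  rewrite mulnAC -mulnA; apply: leq_trans Lle _.
  by rewrite leq_pexp2l ?leq_pmulr ?muln_gt0 ?c0 ?N0 ?t0.
have cardW : #|W| = (#|U| * (t * 2))%N.
  by rewrite !card_prod card_sig card_ord card_bool -mulnA.
rewrite -(leq_pmul2r (_ : 0 < t * 2)%N) ?muln_gt0 ?t0// -cardW mulnAC.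
have := kapP i; set X := (X in #|X|); apply: leq_trans.
rewrite leq_mul2l; apply/orP; right.
apply: leq_trans (leq_imset_card (fun w : W => val w.1.1) X).
apply/subset_leq_card/subsetP => u; rewrite inE => /andP[uU].
move=> /existsP[a /existsP[b /and3P[ai bi Eab]]].
have : ~~ [forall l, forall z,
    sign_pair (dot m (y (exist _ u uU, l, z)) (x a)) ==
    sign_pair (dot m (y (exist _ u uU, l, z)) (x b))].
  apply: contra Eab => /forallP same; apply/eqP.
  congr (Phi _ && Phi _); apply/ffunP => l; rewrite !ffunE.
    by have /forallP/(_ true)/eqP := same l; rewrite !dotE => -[].
  by have /forallP/(_ false)/eqP := same l; rewrite !dotE => -[].
case/forallPn => l /forallPn[z diff]; apply/imsetP.
exists (exist _ u uU, l, z) => //; rewrite inE.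
by apply/existsP; exists a; apply/existsP; exists b; rewrite ai bi.
Qed.

(** * Large homogeneous sets *)

(** The relation E is seen as a colouring of pairs: b = true gives cliques,
    b = false independent sets. *)
Definition monochromatic (V : finType) (E : rel V) (b : bool) (Q : {set V}) :=
  forall u v, u \in Q -> v \in Q -> u != v -> E u v = b.

Lemma subset_of_card (V : finType) (A : {set V}) k : (k <= #|A|)%N ->
  exists2 B : {set V}, B \subset A & #|B| = k.
Proof.
case/card_geqP => s [s_uniq <- sA]; exists [set v in s].
  by apply/subsetP => v; rewrite inE => /sA.
by rewrite cardsE; apply/card_uniqP.
Qed.

Lemma pigeonhole (V L : finType) (U : {set V}) (kap : V -> L) : U != set0 ->
  exists i, (#|U| <= #|L| * #|[set u in U | kap u == i]|)%N.
Proof.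
case/set0Pn => u0 _.
case: (@arg_maxnP _ (kap u0) predT (fun i => #|[set u in U | kap u == i]|)) => //.
move=> i _ imax; exists i.
rewrite -[#|U|]sum1_card (partition_big kap predT)//= -sum_nat_const.
by apply: leq_sum => j _; rewrite sum1dep_card; apply: imax.
Qed.

(** In a cutting with N = 4, the largest class A0 is seen constantly by three
    quarters of U, so at least 3/8 of U sees A0 with one and the same colour.
    Cutting A0 down to an eighth of U leaves room for a disjoint B. *)
Lemma homogeneous_pair c : exists2 e, (0 < e)%N & forall (V : finType) (E : rel V),
  cuttable c E -> forall U : {set V}, (2 ^ e < #|U|)%N ->
  exists A B : {set V}, exists b, [/\ A \subset U, B \subset U, [disjoint A & B],
    (#|U| <= 2 ^ e * #|A|)%N /\ (#|U| <= 2 ^ e * #|B|)%N &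
    {in A & B, forall x y, E x y = b}].
Proof.
exists ((c * 4) ^ c + 4)%N; first by rewrite addn4.
move=> V E cutE U; set n := (2 ^ _)%N => ltU.
have n16 : (16 <= n)%N by rewrite -[16%N]/(2 ^ 4)%N leq_pexp2l ?leq_addl.
have nc : ((c * 4) ^ c <= n)%N.
  apply: (@leq_trans (2 ^ ((c * 4) ^ c))%N); first by rewrite ltnW// ltn_expl.
  by rewrite leq_pexp2l ?leq_addr.
have [//|L [kap [Lle kapP]]] := cutE U 4%N.
have U0 : U != set0 by rewrite -card_gt0 (leq_ltn_trans _ ltU).
have [i Ui] := pigeonhole kap U0.
set A0 := [set u in U | kap u == i] in Ui.
set X := [set u in U | separates E kap i u] in kapP.
have {kapP} := kapP i; rewrite -/X => Xle.
have A0U : A0 \subset U by apply/subsetP => u; rewrite inE => /andP[].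
have XU : X \subset U by apply/subsetP => u; rewrite inE => /andP[].
have {}Ui : (#|U| <= n * #|A0|)%N.
  by apply: leq_trans Ui _; rewrite leq_mul2r (leq_trans Lle nc) orbT.
have [a0 a0A] : exists a0, a0 \in A0.
  by apply/set0Pn; apply: contraTneq Ui => ->; rewrite cards0 muln0 leqn0 cards_eq0.
have const a b : a \in A0 -> b \in U :\: X -> E a b = E a0 b.
  rewrite !inE => /andP[_ ai]; rewrite negb_and => /andP[+ bU]; rewrite bU /=.
  apply: contraNeq => Eab; apply/existsP; exists a; apply/existsP; exists a0.
  by move: a0A; rewrite inE Eab ai andbT => /andP[].
pose part b := [set y in U :\: X | E a0 y == b].
have [b part_ge] : exists b, (3 * #|U| <= 8 * #|part b|)%N.
  have : (#|part true| + #|part false| = #|U| - #|X|)%N.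
    rewrite -(setIidPr XU) -cardsD -(cardsID [set y | E a0 y] (U :\: X)).
    by congr addn; apply: eq_card => y; rewrite !inE; case: (E a0 y); rewrite ?andbT ?andbF.
  have [|lt] := leqP (3 * #|U|) (8 * #|part true|); first by exists true.
  by move=> sum; exists false; have := subset_leq_card XU; lia.
have [A AA0 cardA] := subset_of_card (geq_minl #|A0| (#|U| %/ 8)).
exists A, (part b :\: A), b; split.
- exact: subset_trans AA0 A0U.
- by apply/subsetP => y; rewrite !inE => /andP[_ /andP[/andP[]]].
- by rewrite -setI_eq0 setIDA setDIl setDv set0I.
- have := cardsID A (part b); have := subset_leq_card (subsetIr (part b) A).
  have U16 : (16 < #|U|)%N by apply: leq_ltn_trans ltU.
  split; first by rewrite cardA /minn; case: ltnP => // _; nia.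
  have : (8 * #|A| <= #|U|)%N by rewrite cardA; lia.
  by nia.
- move=> x y /(subsetP AA0) xA; rewrite !inE => /andP[_ /andP[yU /eqP <-]].
  by apply: const => //; rewrite !inE.
Qed.

Lemma monochromatic_union (V : finType) (E : rel V) (A B Q Q' : {set V}) b :
  symmetric E -> Q \subset A -> Q' \subset B -> {in A & B, forall x y, E x y = b} ->
  monochromatic E b Q -> monochromatic E b Q' -> monochromatic E b (Q :|: Q').
Proof.
move=> symE /subsetP QA /subsetP QB EAB clQ clQ' u v.
rewrite !inE => /orP[uQ|uQ] /orP[vQ|vQ] uv.
- exact: clQ.
- by apply: EAB; [apply: QA|apply: QB].
- by rewrite symE; apply: EAB; [apply: QA|apply: QB].
- exact: clQ'.
Qed.

Lemma exists_larger (V : finType) (p : {set V} -> Prop) (A B : {set V}) :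
  p A -> p B -> exists C : {set V}, [/\ p C, (#|A| <= #|C|)%N & (#|B| <= #|C|)%N].
Proof.
move=> pA pB; have [AB|/ltnW BA] := leqP #|A| #|B|; first by exists B.
by exists A.
Qed.

(** The product of the clique and independence numbers is superadditive over
    homogeneous pairs: if A and B are joined completely, their cliques unite, while
    the larger independent set is kept.  Two parts of relative size at least
    2^-e then reproduce the bound, because (x + y)^e >= 2^e min(x, y)^e. *)
Lemma polynomial_ramsey c : exists2 e, (0 < e)%N & forall (V : finType) (E : rel V),
  symmetric E -> cuttable c E -> forall U : {set V},
  exists Q I : {set V}, [/\ Q \subset U, I \subset U,
    monochromatic E true Q, monochromatic E false I & (#|U| <= (#|Q| * #|I|) ^ e)%N].
Proof.
have [e e0 eP] := homogeneous_pair c; exists e => // V E symE cutE U.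
have [k] := ubnP #|U|; elim: k U => // k IH U; rewrite ltnS => leU.
have [U1|U_gt1] := leqP #|U| 1.
  have clU b : monochromatic E b U.
    by move=> u v uU vU; rewrite (card_le1_eqP U1 u v uU vU) eqxx.
  exists U, U; split=> //; case: #|U| U1 => [|[]] //.
  by rewrite exp1n.
have [small|large] := leqP #|U| (2 ^ e).
  have [u [v [uU vU uv]]] := card_gt1P U_gt1.
  have cl2 : monochromatic E (E u v) [set u; v].
    move=> x y; rewrite !inE => /orP[] /eqP -> /orP[] /eqP ->;
      by [rewrite eqxx | | rewrite symE | rewrite eqxx].
  have cl1 b : monochromatic E b [set u].
    by move=> x y; rewrite !inE => /eqP -> /eqP ->; rewrite eqxx.
  have sub2 : [set u; v] \subset U by rewrite subUset !sub1set uU.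
  have sub1 : [set u] \subset U by rewrite sub1set.
  case: (E u v) cl2 => cl2.
    by exists [set u; v], [set u]; split; rewrite // cards2 cards1 uv muln1.
  by exists [set u], [set u; v]; split; rewrite // cards2 cards1 uv mul1n.
have [A [B [b [AU BU AB0 [UA UB] EAB]]]] := eP V E cutE U large.
have cardAB : (#|A| + #|B| <= #|U|)%N.
  rewrite -(eqP (_ : #|A :|: B| == #|A| + #|B|)%N); last by rewrite (leq_card_setU A B).
  by rewrite subset_leq_card// subUset AU.
have U_gt0 : (0 < #|U|)%N by apply: leq_trans U_gt1.
have A0 : (0 < #|A|)%N by rewrite lt0n; apply: contraTneq UA => ->; rewrite muln0 -ltnNge.
have B0 : (0 < #|B|)%N by rewrite lt0n; apply: contraTneq UB => ->; rewrite muln0 -ltnNge.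
have [|QA [IA [QAs IAs clQA clIA leA]]] := IH A.
  by apply: leq_trans leU; rewrite -addn1 (leq_trans _ cardAB)// leq_add2l.
have [|QB [IB [QBs IBs clQB clIB leB]]] := IH B.
  by apply: leq_trans leU; rewrite -add1n (leq_trans _ cardAB)// leq_add2r.
have powP x y : (#|A| <= x ^ e)%N -> (#|B| <= y ^ e)%N -> (#|U| <= (x + y) ^ e)%N.
  move=> Ax By; have [xy|/ltnW yx] := leqP x y.
    apply: leq_trans UA _; apply: leq_trans (leq_mul (leqnn _) Ax) _.
    by rewrite -expnMn leq_expl// mul2n -addnn leq_add2l.
  apply: leq_trans UB _; apply: leq_trans (leq_mul (leqnn _) By) _.
  by rewrite -expnMn leq_expl// mul2n -addnn leq_add2r.
have {powP} := powP _ _ leA leB => leU'.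
have dis (Q Q' : {set V}) : Q \subset A -> Q' \subset B -> #|Q :|: Q'| = (#|Q| + #|Q'|)%N.
  move=> QA' QB'; apply/eqP; rewrite (leq_card_setU Q Q').
  by rewrite (disjointW _ _ AB0)//; apply/subsetP.
case: b EAB => EAB.
  have [|I [[IU clI] IAI IBI]] := @exists_larger _
      (fun I => I \subset U /\ monochromatic E false I) IA IB _
      (conj (subset_trans IBs BU) clIB).
    by split=> //; apply: subset_trans AU.
  exists (QA :|: QB), I; split=> //.
    by rewrite subUset (subset_trans QAs)// (subset_trans QBs).
    exact: monochromatic_union EAB clQA clQB.
  apply: leq_trans leU' _; rewrite leq_expl// dis// mulnDl.
  by rewrite leq_add// leq_mul.
have [|Q [[QU clQ] QAQ QBQ]] := @exists_larger _
    (fun Q => Q \subset U /\ monochromatic E true Q) QA QB _ (conj (subset_trans QBs BU) clQB).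
  by split=> //; apply: subset_trans AU.
exists Q, (IA :|: IB); split=> //.
  by rewrite subUset (subset_trans IAs)// (subset_trans IBs).
  exact: monochromatic_union EAB clIA clIB.
apply: leq_trans leU' _; rewrite leq_expl// dis// mulnDr.
by rewrite leq_add// leq_mul.
Qed.

Corollary large_homogeneous_set c : exists e, forall (V : finType) (E : rel V),
  symmetric E -> cuttable c E -> forall (U : {set V}) s, (s ^ e <= #|U|)%N ->
  exists b (Q : {set V}), [/\ Q \subset U, monochromatic E b Q & #|Q| = s].
Proof.
have [e e0 eP] := polynomial_ramsey c; exists (2 * e)%N => V E symE cutE U s leU.
case: s leU => [_|s leU].
  exists true, set0; rewrite sub0set cards0; split=> // u v.
  by rewrite inE.
have [Q [I [QU IU clQ clI leQI]]] := eP V E symE cutE U.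
have sub_clique b (X Y : {set V}) : X \subset Y -> monochromatic E b Y -> monochromatic E b X.
  by move=> /subsetP XY clY u v /XY uY /XY vY; apply: clY.
have [/subset_of_card[Q' Q'Q Q's]|ltQ] := leqP s.+1 #|Q|.
  exists true, Q'; split=> //; first exact: subset_trans QU.
  exact: sub_clique clQ.
have [/subset_of_card[I' I'I I's]|ltI] := leqP s.+1 #|I|.
  exists false, I'; split=> //; first exact: subset_trans IU.
  exact: sub_clique clI.
exfalso; have := leq_trans leU leQI; apply/negP; rewrite -ltnNge.
apply: (@leq_ltn_trans ((s * s) ^ e)%N); first by rewrite leq_expl// leq_mul.
by rewrite expnM -mulnn ltn_exp2r// ltn_mul.
Qed.

(** * Representatives of the classes *)

Section CheapChoice.
Variables (K : realFieldType) (I V : finType) (A : I -> {set V}).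
Hypothesis A_neq0 : forall i, A i != set0.

Let weight i x : K := (x \in A i)%:R / #|A i|%:R.
Let prob (w : {ffun I -> V}) := \prod_i weight i (w i).

Local Lemma cardA_neq0 i : #|A i|%:R != 0 :> K.
Proof. by rewrite pnatr_eq0 cards_eq0. Qed.

Local Lemma mean_weight i (h : V -> K) :
  \sum_x weight i x * h x = (\sum_(x in A i) h x) / #|A i|%:R.
Proof.
rewrite mulr_suml [RHS]big_mkcond /=; apply: eq_bigr => x _.
by rewrite /weight; case: (x \in A i); rewrite ?mul0r// mulrAC mul1r mulrC.
Qed.

Local Lemma sum_weight i : \sum_x weight i x = 1.
Proof.
have := mean_weight i (fun=> 1); rewrite sumr_const divff ?cardA_neq0// => <-.
by apply: eq_bigr => x _; rewrite mulr1.
Qed.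

Local Lemma mean_prod (h : I -> V -> K) :
  \sum_w prob w * \prod_i h i (w i) = \prod_i \sum_x weight i x * h i x.
Proof.
rewrite bigA_distr_bigA /=; apply: eq_bigr => w _.
by rewrite -big_split.
Qed.

Local Lemma sum_prob : \sum_w prob w = 1.
Proof.
by rewrite /prob -(bigA_distr_bigA weight) big1// => i _; apply: sum_weight.
Qed.

Local Lemma mean_single i (h : V -> K) :
  \sum_w prob w * h (w i) = (\sum_(x in A i) h x) / #|A i|%:R.
Proof.
have := mean_prod (fun k x => if k == i then h x else 1).
rewrite [RHS](bigD1 i)//= eqxx mean_weight [X in _ * X]big1 ?mulr1 => [<-|k ki].
  apply: eq_bigr => w _; rewrite (bigD1 i)//= eqxx big1 ?mulr1// => k ki.
  by rewrite (negbTE ki).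
by rewrite -[RHS](sum_weight k); apply: eq_bigr => x _; rewrite (negbTE ki) mulr1.
Qed.

Local Lemma mean_product i j (u v : V -> K) : i != j ->
  \sum_w prob w * (u (w i) * v (w j)) =
  (\sum_(x in A i) u x) / #|A i|%:R * ((\sum_(x in A j) v x) / #|A j|%:R).
Proof.
move=> ij; have ji : j != i by rewrite eq_sym.
have := mean_prod (fun k x => if k == i then u x else if k == j then v x else 1).
rewrite [RHS](bigD1 i)//= eqxx mean_weight (bigD1 j)//= (negbTE ji) eqxx mean_weight.
rewrite [X in _ * (_ * X)]big1 ?mulr1 => [<-|k /andP[ki kj]].
  apply: eq_bigr => w _; congr (_ * _).
  rewrite (bigD1 i)//= eqxx (bigD1 j)//= (negbTE ji) eqxx big1 ?mulr1// => k /andP[ki kj].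
  by rewrite (negbTE ki) (negbTE kj).
rewrite -[RHS](sum_weight k); apply: eq_bigr => x _.
by rewrite (negbTE ki) (negbTE kj) mulr1.
Qed.

Local Lemma mean_pair i j (g : V -> V -> K) : i != j ->
  \sum_w prob w * g (w i) (w j) =
  (\sum_(x in A i) \sum_(y in A j) g x y) / (#|A i|%:R * #|A j|%:R).
Proof.
move=> ij.
transitivity (\sum_a \sum_w prob w * ((w i == a)%:R * g a (w j))).
  rewrite exchange_big /=; apply: eq_bigr => w _.
  rewrite -mulr_sumr; congr (_ * _); rewrite (bigD1 (w i))//= eqxx mul1r.
  by rewrite big1 ?addr0// => a; rewrite eq_sym => /negbTE ->; rewrite mul0r.
under eq_bigr => a _ do rewrite (mean_product (fun x => (x == a)%:R) (g a) ij).
rewrite [in RHS]mulr_suml [RHS]big_mkcond /=; apply: eq_bigr => a _.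
case: ifPn => aA.
  rewrite (bigD1 a)//= eqxx big1 ?addr0 => [|x /andP[_ /negbTE ->//]].
  by rewrite mulf_div mul1r.
rewrite big1 ?mul0r// => x xA; case: eqP xA aA => // ->.
by move=> ->.
Qed.

(** The right-hand side is the mean of the left-hand side when the w i are
    independent and uniform in the A i. *)
Lemma exists_cheap_choice (f : I -> V -> K) (g : I -> I -> V -> V -> K) :
  exists w : I -> V, (forall i, w i \in A i) /\
  \sum_i f i (w i) + \sum_i \sum_(j | j != i) g i j (w i) (w j) <=
  \sum_i (\sum_(x in A i) f i x) / #|A i|%:R +
  \sum_i \sum_(j | j != i)
    (\sum_(x in A i) \sum_(y in A j) g i j x y) / (#|A i|%:R * #|A j|%:R).
Proof.
pose F (w : I -> V) :=
  \sum_i f i (w i) + \sum_i \sum_(j | j != i) g i j (w i) (w j).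
pose m := \sum_i (\sum_(x in A i) f i x) / #|A i|%:R +
  \sum_i \sum_(j | j != i)
    (\sum_(x in A i) \sum_(y in A j) g i j x y) / (#|A i|%:R * #|A j|%:R).
suff: exists w : I -> V, (forall i, w i \in A i) /\ F w <= m by [].
have meanF : \sum_w prob w * F w = m.
  rewrite /F /m; under eq_bigr => w _ do rewrite mulrDr !mulr_sumr.
  rewrite big_split /= exchange_big [X in _ + X]exchange_big /=.
  congr (_ + _); apply: eq_bigr => i _; first by rewrite mean_single.
  under eq_bigr => w _ do rewrite mulr_sumr.
  rewrite exchange_big /=; apply: eq_bigr => j ji.
  by rewrite mean_pair// eq_sym.
have [w0 w0A] : exists w0 : {ffun I -> V}, forall i, w0 i \in A i.
  have [w wA] := fin_all_exists (fun i => set0Pn _ (A_neq0 i)).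
  by exists (finfun w) => i; rewrite ffunE.
have prob_gt0 (w : {ffun I -> V}) : (forall i, w i \in A i) -> 0 < prob w.
  by move=> wA; apply: prodr_gt0 => i _; rewrite /weight wA divr_gt0// lt0r cardA_neq0 ler0n.
have [/existsP[w /andP[/forallP wA le_m]]|no_w] :=
    boolP [exists w : {ffun I -> V}, [forall i, w i \in A i] && (F w <= m)].
  by exists w.
exfalso.
have gt_m (w : {ffun I -> V}) : (forall i, w i \in A i) -> m < F w.
  move=> wA; rewrite ltNge; apply: contra no_w => le_m.
  by apply/existsP; exists w; rewrite le_m andbT; apply/forallP.
have terms_ge0 (w : {ffun I -> V}) : 0 <= prob w * (F w - m).
  have [/forallP wA|/forallPn[i wi]] := boolP [forall i, w i \in A i].
    by rewrite mulr_ge0 ?subr_ge0// ltW ?prob_gt0 ?gt_m.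
  by rewrite /prob (bigD1 i)//= /weight (negbTE wi) !mul0r.
have sum0 : \sum_w prob w * (F w - m) = 0.
  under eq_bigr => w _ do rewrite mulrBr.
  by rewrite sumrB meanF -mulr_suml sum_prob mul1r subrr.
have /(_ w0 isT)/eqP := psumr_eq0P (fun w _ => terms_ge0 w) sum0.
by rewrite mulf_eq0 gt_eqF ?prob_gt0// subr_eq0 gt_eqF ?gt_m.
Qed.
End CheapChoice.

(** The three kinds of defects have total mean at most 1/8 + 1/8 + 1/4 once the last
    is weighted by N / (4 n^2), so some choice costs less than 1; the defects of
    the first two kinds are counted by integers and must vanish.  The field K only
    serves to compute means. *)
Lemma good_representatives (K : realFieldType) (I V : finType) (A : I -> {set V}) (n N r : nat)
    (bad1 : I -> pred V) (bad2 : I -> I -> rel V) (bad3 : I -> I -> pred V) :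
  (0 < #|I| <= r)%N -> (0 < n)%N -> (0 < N)%N -> (forall i, A i != set0) ->
  (forall i, (8 * r * #|[set x in A i | bad1 i x]| <= #|A i|)%N) ->
  (forall i j x, j != i -> x \in A i ->
     (8 * r ^ 2 * #|[set y in A j | bad2 i j x y]| <= #|A j|)%N) ->
  (N * (\sum_i \sum_(j | j != i) #|A j| * #|[set x in A i | bad3 i j x]|)
     <= n ^ 2)%N ->
  exists w : I -> V, [/\ forall i, w i \in A i, forall i, ~~ bad1 i (w i),
    forall i j, j != i -> ~~ bad2 i j (w i) (w j) &
    (N * (\sum_i \sum_(j | j != i) #|A i| * #|A j| * bad3 i j (w i))
      <= 4 * n ^ 2)%N].
Proof.
move=> /andP[I0 Ir] n0 N0 A0 le1 le2 le3.
have r0 : (0 < r)%N by apply: leq_trans Ir.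
pose coef : K := N%:R / (4 * n%:R ^+ 2).
have coef0 : 0 < coef by rewrite divr_gt0 ?mulr_gt0 ?exprn_gt0 ?ltr0n.
have [w [wA]] := exists_cheap_choice A0 (fun i x => (bad1 i x)%:R)
  (fun i j x y => (bad2 i j x y)%:R +
     coef * (#|A i| * #|A j| * bad3 i j x)%:R : K).
set S1 := \sum_i (bad1 i (w i))%:R; set S2 := \sum_i \sum_(j | j != i) _ => le_ST.
set T1 := (X in _ <= X + _) in le_ST; set T2 := (X in _ <= _ + X) in le_ST.
have cardA0 i : 0 < #|A i|%:R :> K by rewrite ltr0n card_gt0.
have T1_le : T1 <= 1 / 8.
  apply: (@le_trans _ _ (\sum_(i : I) (8 * r%:R)^-1)).
    apply: ler_sum => i _; rewrite -natr_sum -big_mkcondr sum1dep_card.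
    rewrite ler_pdivrMr// mulrC ler_pdivlMr ?mulr_gt0 ?ltr0n//.
    by rewrite mulrC -!natrM ler_nat le1.
  rewrite sumr_const -[_^-1 *+ _]mulr_natl ler_pdivrMr ?mulr_gt0 ?ltr0n//.
  by rewrite mul1r mulKf ?pnatr_eq0 ?ler_nat.
pose T21 : K := \sum_(i : I) \sum_(j : I | j != i) (8 * r%:R ^+ 2)^-1.
pose T22 := (\sum_i \sum_(j | j != i) #|A j| * #|[set x in A i | bad3 i j x]|)%N.
have T2_le : T2 <= T21 + coef * T22%:R.
  rewrite natr_sum mulr_sumr -big_split; apply: ler_sum => i _ /=.
  rewrite natr_sum mulr_sumr -big_split; apply: ler_sum => j ji /=.
  rewrite ler_pdivrMr ?mulr_gt0//.
  under eq_bigr => x _ do rewrite big_split sumr_const /=.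
  rewrite big_split /= mulrDl lerD//.
    rewrite mulrCA [#|A i|%:R * _]mulr_natl -sumr_const ler_sum// => x xA.
    rewrite -natr_sum -big_mkcondr sum1dep_card mulrC ler_pdivlMr.
      by rewrite mulrC -natrX -!natrM ler_nat le2.
    by rewrite mulr_gt0 ?exprn_gt0 ?ltr0n.
  rewrite (_ : \sum_(x in A i) _ =
      coef * #|A i|%:R * #|A j|%:R ^+ 2 * \sum_(x in A i) (bad3 i j x)%:R).
    rewrite -natr_sum -big_mkcondr sum1dep_card !natrM le_eqVlt; apply/orP; left.
    by apply/eqP; ring.
  rewrite mulr_sumr; apply: eq_bigr => x _.
  by rewrite -[_ *+ #|A j|]mulr_natl !natrM; ring.
have T21_le : T21 <= 1 / 8.
  apply: (@le_trans _ _ (\sum_(i : I) \sum_(j : I) (8 * r%:R ^+ 2)^-1)).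
    apply: ler_sum => i _; rewrite [leRHS](bigID (fun j => j != i))/= lerDl.
    by rewrite sumr_ge0// => j _; rewrite invr_ge0 mulr_ge0 ?exprn_ge0.
  rewrite !sumr_const -!mulrnA -[_^-1 *+ _]mulr_natl.
  rewrite ler_pdivrMr ?mulr_gt0 ?exprn_gt0 ?ltr0n//.
  by rewrite mul1r mulKf ?pnatr_eq0// -natrX ler_nat leq_mul.
have T22_le : coef * T22%:R <= 1 / 4.
  rewrite mulrAC ler_pdivrMr ?mulr_gt0 ?exprn_gt0 ?ltr0n//.
  by rewrite mul1r mulKf ?pnatr_eq0// -natrX -natrM ler_nat.
have S1_ge i : (bad1 i (w i))%:R <= S1.
  by rewrite /S1 (bigD1 i)//= lerDl sumr_ge0.
pose S21 := \sum_i \sum_(j | j != i) (bad2 i j (w i) (w j))%:R : K.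
pose S22 := (\sum_i \sum_(j | j != i) #|A i| * #|A j| * bad3 i j (w i))%N.
have S2E : S2 = S21 + coef * S22%:R.
  rewrite natr_sum mulr_sumr -big_split; apply: eq_bigr => i _ /=.
  by rewrite natr_sum mulr_sumr -big_split.
have S1_ge0 : 0 <= S1 by apply: sumr_ge0.
have S21_ge0 : 0 <= S21 by apply: sumr_ge0 => i _; apply: sumr_ge0.
have S22_ge0 : 0 <= coef * S22%:R by rewrite mulr_ge0 ?ler0n// ltW.
have small (a b e : K) : 0 <= a -> 0 <= b -> 0 <= e ->
    a + b + e <= 1 / 8 + 1 / 8 + 1 / 4 -> [/\ a < 1, b < 1 & e <= 1].
  by move=> a0 b0 e0 abe; split; lra.
have [||||S1_lt S21_lt S22_le] := small S1 S21 (coef * S22%:R) => //.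
  rewrite -addrA -S2E; apply: le_trans le_ST _; rewrite -addrA lerD//.
  by apply: le_trans T2_le _; rewrite lerD.
exists w; split=> // [i|i j ji|].
- have := le_lt_trans (S1_ge i) S1_lt.
  by case: (bad1 i (w i)) => //; rewrite ltxx.
- have : (bad2 i j (w i) (w j))%:R <= S21.
    rewrite /S21 (bigD1 i)//= (bigD1 j)//= -addrA lerDl addr_ge0 ?sumr_ge0//.
    by move=> k _; apply: sumr_ge0.
  move=> /le_lt_trans/(_ S21_lt).
  by case: (bad2 i j (w i) (w j)) => //; rewrite ltxx.
- move: S22_le; rewrite mulrAC ler_pdivrMr ?mulr_gt0 ?exprn_gt0 ?ltr0n// mul1r.
  by rewrite -natrX -!natrM ler_nat.
Qed.

(** * A homogeneous model of the graph *)

Lemma card_by_class (V L : finType) (kap : V -> L) (S : {set V}) :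
  (#|S| = \sum_l #|[set x in S | kap x == l]|)%N.
Proof.
rewrite -sum1_card (partition_big kap predT)//=.
by apply: eq_bigr => l _; rewrite sum1dep_card; apply: eq_card => x; rewrite !inE.
Qed.

Lemma few_in_small_classes (V L : finType) (kap : V -> L) (A : {set V}) M :
  (M * #|[set x in A | (M * #|[set y in A | kap y == kap x]| < #|A|)%N]|
    <= #|L| * #|A|)%N.
Proof.
set S := [set x in A | _]; rewrite (card_by_class kap S) big_distrr /=.
rewrite -sum_nat_const; apply: leq_sum => l _.
have [->|[x]] := set_0Vmem [set x in S | kap x == l]; first by rewrite cards0 muln0.
rewrite !inE => /andP[/andP[xA small] /eqP xl].
apply: leq_trans (ltnW small); rewrite leq_mul2l; apply/orP; right.
apply/subset_leq_card/subsetP => y; rewrite !inE xl.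
by move=> /andP[/andP[-> _] ->].
Qed.

(** A point x is counted when X fills more than a fraction 1/M of its class. *)
Lemma few_in_crowded_classes (V L : finType) (kap : V -> L) (A X : {set V}) M :
  (#|[set x in A | (#|[set y in A | kap y == kap x]|
                     < M * #|[set y in A :&: X | kap y == kap x]|)%N]|
    <= M * #|A :&: X|)%N.
Proof.
set S := [set x in A | _]; rewrite (card_by_class kap S).
rewrite (card_by_class kap (A :&: X)) big_distrr /=; apply: leq_sum => l _.
have [->|[x]] := set_0Vmem [set x in S | kap x == l]; first by rewrite cards0.
rewrite !inE => /andP[/andP[xA crowded] /eqP xl].
rewrite xl in crowded; apply: leq_trans (ltnW crowded).
apply/subset_leq_card/subsetP => y; rewrite !inE.
by move=> /andP[/andP[-> _] ->].
Qed.

Lemma count_modn n N a : (a < N)%N ->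
  count (fun i => i %% N == a)%N (iota 0 n) = ((n + (N - a.+1)) %/ N)%N.
Proof.
move=> aN; elim: n => [|n IH].
  by rewrite add0n divn_small//; lia.
rewrite -addn1 iotaD count_cat IH /= add0n addn0 addn1 addSn divnS; last by lia.
rewrite addnC; congr (nat_of_bool _ + _)%N.
have -> : (n %% N == a)%N = (n == a %[mod N])%N by rewrite (modn_small aN).
rewrite -(eqn_modDr (N - a.+1).+1) addnS.
rewrite (_ : (a + (N - a.+1).+1 = N)%N); last by lia.
by rewrite modnn /dvdn.
Qed.

Lemma split_evenly (V : finType) (B : {set V}) N : (0 < N)%N ->
  exists g : V -> 'I_N, forall a,
  (#|B| %/ N <= #|[set v in B | g v == a]| <= #|B| %/ N + 1)%N.
Proof.
move=> N0; exists (fun v => Ordinal (ltn_pmod (index v (enum B)) N0)) => a.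
set S := [set v in B | _].
have -> : #|S| = count (fun i => i %% N == a)%N (iota 0 #|B|).
  rewrite cardE (_ : iota 0 #|B| = [seq index v (enum B) | v <- enum B]).
    rewrite count_map -size_filter; apply/perm_size/uniq_perm.
    - exact: enum_uniq.
    - by rewrite filter_uniq ?enum_uniq.
    by move=> v; rewrite mem_filter !mem_enum inE andbC.
  apply: (@eq_from_nth _ 0%N) => [|i]; rewrite size_iota ?size_map -?cardE// => iB.
  have [v0 _] : exists v, v \in B by apply/set0Pn; rewrite -card_gt0 (leq_trans _ iB).
  rewrite nth_iota// (nth_map v0) -?cardE// index_uniq ?enum_uniq -?cardE//.
rewrite count_modn// leq_div2r ?leq_addr//=.
have <- : ((#|B| + N) %/ N = #|B| %/ N + 1)%N by rewrite divnDr// divnn N0.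
by rewrite leq_div2r// leq_add2l leq_subr.
Qed.

Lemma leq_sum_inj (J T : finType) (f : J -> T) (F : T -> nat) : injective f ->
  (\sum_j F (f j) <= \sum_t F t)%N.
Proof.
move=> f_inj; rewrite -(big_imset (A := J) F (in2W f_inj)) /=.
by rewrite [leqLHS]big_mkcond leq_sum// => t _; case: ifP.
Qed.

Lemma card_pairs (V : finType) (P : rel V) :
  #|[set p | P p.1 p.2]| = (\sum_u #|[set v | P u v]|)%N.
Proof.
rewrite -sum1_card (eq_bigl (fun p => P p.1 p.2)) => [|p]; last by rewrite inE.
rewrite -(pair_big_dep predT P (fun _ _ => 1%N)) /=.
by apply: eq_bigr => u _; rewrite sum1dep_card; apply: eq_card => v; rewrite !inE.
Qed.

Section Model.
Variables (c : nat) (V : finType) (E : rel V) (N : nat).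
Hypotheses (symE : symmetric E) (cutE : cuttable c E).

(** Number of coarse classes: those of a cutting, each split into N pieces to make
    the pairs inside a class negligible. *)
Definition part_number := ((c * N) ^ c * N)%N.
(** Fine enough for a union bound over all pairs of classes: 24 r^4 N gives the
    hypothesis of [good_representatives] on bad2 for classes of size n / (N r). *)
Definition fine_precision := (24 * part_number ^ 4 * N)%N.
(** Core i has at least a fraction 1 / core_ratio of the vertices: n <= N r |A i|,
    |A i| <= 8 r K2 |Q| for the fine cell Q of the representative, where K2 is the
    number of fine classes, and at most half of Q is discarded. *)
Definition core_ratio :=
  (16 * N * part_number ^ 2 * (c * fine_precision) ^ c)%N.

Lemma part_number_gt0 : (0 < N)%N -> (0 < part_number)%N.
Proof. by move=> N0; rewrite muln_gt0 N0 expn_gt0 muln_gt0 N0; case: (c). Qed.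

Lemma fine_precision_gt0 : (0 < N)%N -> (0 < fine_precision)%N.
Proof.
move=> N0; rewrite /fine_precision; move: part_number (part_number_gt0 N0) => r r0.
by rewrite !muln_gt0 ?expn_gt0 r0 N0.
Qed.

Lemma core_ratio_gt0 : (0 < N)%N -> (0 < core_ratio)%N.
Proof.
move=> N0; rewrite /core_ratio.
move: fine_precision (fine_precision_gt0 N0) part_number (part_number_gt0 N0).
move=> N2 N20 r r0.
have power_gt0 : (0 < (c * N2) ^ c)%N by rewrite expn_gt0 muln_gt0 N20; case: (c).
by rewrite muln_gt0 power_gt0 andbT !muln_gt0 ?expn_gt0 r0 N0.
Qed.

Lemma constant_on_class (L : eqType) (kap : V -> L) (u a b : V) :
  ~~ separates E kap (kap a) u -> kap b = kap a -> E a u = E b u.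
Proof.
move=> nsep ba; apply: contraNeq nsep => Eab.
by apply/existsP; exists a; apply/existsP; exists b; rewrite ba eqxx Eab.
Qed.

(** The core of class i is the fine cell of w i without the vertices that see the
    fine cell of another w j inconstantly.  For a in core i and b in core j,
    b sees a and w i alike, and w i sees b and w j alike; so E a b is E (w i) (w j).
    A pair disagrees with the model only if an endpoint is in a small class, the
    endpoints share a class, or one endpoint, or a representative, sees the class
    on the other side inconstantly: these cases contribute
    1 + 1, 2, 1 and 4 times n^2 / N. *)
Lemma homogeneous_model : (0 < N <= #|V|)%N ->
  exists (I : finType) (pi : V -> I) (w : I -> V) (B : I -> {set V}),
  [/\ (#|I| <= part_number)%N,
      forall i, (#|V| <= core_ratio * #|B i|)%N,
      forall i j, i != j -> [disjoint B i & B j],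
      forall i j, i != j -> {in B i & B j, forall a b, E a b = E (w i) (w j)} &
      (N * #|[set p | (pi p.1 == pi p.2) ||
                      (E p.1 p.2 != E (w (pi p.1)) (w (pi p.2)))]|
        <= 9 * #|V| ^ 2)%N].
Proof.
move=> /andP[N0 NV]; set n := #|V|.
have n0 : (0 < n)%N by apply: leq_trans NV.
have r0 := part_number_gt0 N0; have N2_gt0 := fine_precision_gt0 N0.
rewrite /core_ratio; have : fine_precision = (24 * part_number ^ 4 * N)%N by [].
move: fine_precision N2_gt0 => N2 N2_gt0 N2E.
have : ((c * N) ^ c * N <= part_number)%N by [].
move: part_number r0 N2E => r r0 N2E cN_le.
have [L1 [kap1 [L1le kap1P]]] := cutE [set: V] N0.
have [L2 [kap2 [L2le kap2P]]] := cutE [set: V] N2_gt0.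
have [g gP] := split_evenly [set: V] N0.
pose kap v := (kap1 v, g v).
pose T : finType := (L1 * 'I_N)%type.
have cardT : (#|T| <= r)%N.
  by rewrite card_prod card_ord (leq_trans _ cN_le)// leq_mul2r L1le orbT.
pose A (t : T) := [set v | kap v == t].
pose cross1 (t : T) := [set u | separates E kap t u].
pose cross2 v := [set u | separates E kap2 (kap2 v) u].
have cross1_le t : (N * #|cross1 t| <= n)%N.
  have := kap1P t.1; rewrite cardsT; apply: leq_trans.
  rewrite leq_mul2l; apply/orP; right; apply/subset_leq_card/subsetP => u.
  rewrite !inE => /existsP[a /existsP[b /and3P[/eqP at1 /eqP bt1 Eab]]].
  apply/existsP; exists a; apply/existsP; exists b.
  by rewrite -at1 eqxx at1 -bt1 eqxx.
have cross2_le v : (N2 * #|cross2 v| <= n)%N.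
  have := kap2P (kap2 v); rewrite cardsT; apply: leq_trans.
  rewrite leq_mul2l; apply/orP; right; apply/subset_leq_card/subsetP => u.
  by rewrite !inE.
have A_le t : (#|A t| <= n %/ N + 1)%N.
  have /andP[_] := gP t.2; rewrite cardsT; apply: leq_trans.
  by apply/subset_leq_card/subsetP => u; rewrite !inE => /eqP <- /=.
pose large t := (n <= N * r * #|A t|)%N.
pose I : finType := {t : T | large t}.
have [i0 _] : exists i : I, True.
  have V0 : [set: V] != set0 by rewrite -card_gt0 cardsT.
  have [t] := pigeonhole kap V0; rewrite cardsT -/n => n_le.
  suff large_t : large t by exists (exist _ t large_t).
  apply: leq_trans n_le _; apply: leq_mul; first by rewrite (leq_trans cardT) ?leq_pmull.
  by apply/subset_leq_card/subsetP => v; rewrite !inE.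
pose A' (i : I) := A (val i).
pose Q v := [set u | (kap u == kap v) && (kap2 u == kap2 v)].
have QE t v : v \in A t -> Q v = [set u in A t | kap2 u == kap2 v].
  by rewrite inE => /eqP vt; apply/setP => u; rewrite !inE vt.
pose K2 := ((c * N2) ^ c)%N.
have K2_gt0 : (0 < K2)%N.
  by rewrite expn_gt0 muln_gt0 N2_gt0; case: (c).
have sum_classes_le (X : {set V}) : (\sum_(i : I) #|[set x in A' i | x \in X]| <= #|X|)%N.
  rewrite (card_by_class kap X).
  apply: leq_trans (leq_sum_inj (fun t => #|[set x in X | kap x == t]|) val_inj).
  by apply: leq_sum => i _; apply/subset_leq_card/subsetP => x; rewrite !inE andbC.
have sum_A' : (\sum_(i : I) #|A' i| <= n)%N.
  apply: leq_trans (max_card [set: V]); apply: leq_trans (sum_classes_le setT).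
  by apply: leq_sum => i _; apply/subset_leq_card/subsetP => x; rewrite !inE andbT.
pose bad1 (i : I) x := (8 * r * K2 * #|Q x| < #|A' i|)%N.
pose bad2 (i j : I) x y := (y \in cross2 x) || (#|Q y| < 2 * r * #|Q y :&: cross2 x|)%N.
pose bad3 (i j : I) x := x \in cross1 (val j).
have [] := @good_representatives rat I V A' n N r bad1 bad2 bad3 => //.
- rewrite (leq_trans _ cardT) ?andbT; last first.
    by rewrite card_sig; apply: max_card.
  by apply/card_gt0P; exists i0.
- move=> i; rewrite -card_gt0 lt0n; apply: contraTneq (valP i) => A0.
  by rewrite /large A0 muln0 -ltnNge.
- move=> i; have := few_in_small_classes kap2 (A' i) (8 * r * K2).
  set S := [set x in _ | _]; set S' := [set x in _ | _] => S_le.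
  have <- : S = S'.
    by apply/setP => x; rewrite !inE /bad1; case: eqP => //= xA; rewrite (QE (val i)) ?inE ?xA.
  rewrite -(leq_pmul2r K2_gt0) -mulnA [(_ * K2)%N]mulnC mulnA.
  by apply: leq_trans S_le _; rewrite mulnC leq_mul.
- move=> i j x ji xA.
  apply: (@leq_trans (8 * r ^ 2 * (3 * r * #|cross2 x|))%N).
    rewrite leq_mul2l; apply/orP; right.
    have := few_in_crowded_classes kap2 (A' j) (cross2 x) (2 * r).
    set S := [set y in _ | _] => S_le.
    apply: (@leq_trans #|cross2 x :|: S|).
      apply/subset_leq_card/subsetP => y; rewrite inE => /andP[yA /orP[yx|crowd]].
        by rewrite in_setU yx.
      rewrite in_setU [y \in S]inE yA; apply/orP; right; move: crowd.
      have -> : [set z in A' j :&: cross2 x | kap2 z == kap2 y] = Q y :&: cross2 x.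
        by rewrite (QE (val j))//; apply/setP => z; rewrite !inE andbAC.
      by rewrite (QE (val j)).
    apply: leq_trans (leq_card_setU _ _) _.
    have := subset_leq_card (subsetIr (A' j) (cross2 x)); nia.
  rewrite -(leq_pmul2l (_ : 0 < N * r)%N) ?muln_gt0 ?N0//.
  apply: leq_trans _ (valP j); apply: leq_trans _ (cross2_le x).
  by rewrite N2E; apply: eq_leq; ring.
- rewrite (exchange_big_dep predT)//= big_distrr /=.
  apply: (@leq_trans (\sum_(j : I) #|A' j| * n)%N).
    apply: leq_sum => j _; rewrite -big_distrr /= mulnCA leq_mul2l; apply/orP; right.
    apply: leq_trans (cross1_le (val j)); rewrite leq_mul2l; apply/orP; right.
    apply: leq_trans (sum_classes_le (cross1 (val j))).
    by rewrite [leqLHS]big_mkcond leq_sum// => i _; case: ifP.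
  rewrite -big_distrl /= leq_mul2r sum_A' orbT//.
move=> w [wA ok1 ok2 sum3].
exists I, (fun v => insubd i0 (kap v)), w.
exists (fun i => Q (w i) :\: \bigcup_(j | j != i) cross2 (w j)).
pose cross i := \bigcup_(j | j != i) cross2 (w j).
have w_class (i : I) : kap (w i) = val i by have := wA i; rewrite inE => /eqP.
have mem_core i x : x \in Q (w i) :\: cross i ->
    [/\ kap x = val i, kap2 x = kap2 (w i) & forall j, j != i -> x \notin cross2 (w j)].
  rewrite !inE w_class => /andP[xc /andP[/eqP xi /eqP x2]]; split=> // j ji.
  by apply: contra xc => xj; apply/bigcupP; exists j.
split.
- rewrite (leq_trans _ cardT)// card_sig; exact: max_card.
- move=> i; rewrite -/n -/(cross i).
  have Q_half : (#|Q (w i)| <= 2 * #|Q (w i) :\: cross i|)%N.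
    have Ir : (#|I| <= r)%N by rewrite (leq_trans _ cardT)// card_sig; apply: max_card.
    have : (2 * #|Q (w i) :&: cross i| <= #|Q (w i)|)%N.
      rewrite -(leq_pmul2l r0) mulnA [(r * 2)%N]mulnC.
      apply: (@leq_trans (\sum_(j : I | j != i) 2 * r * #|Q (w i) :&: cross2 (w j)|)%N).
        rewrite -big_distrr leq_mul2l; apply/orP; right.
        apply: leq_trans (leq_card_bigcup (fun j => Q (w i) :&: cross2 (w j)) _).
        apply/subset_leq_card/subsetP => x /setIP[xQ /bigcupP[j ji xj]].
        by apply/bigcupP; exists j => //; rewrite inE xQ.
      apply: (@leq_trans (\sum_(j : I) #|Q (w i)|)%N).
        rewrite [leqLHS]big_mkcond; apply: leq_sum => j _; case: ifPn => // ji.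
        have := ok2 j i; rewrite eq_sym => /(_ ji).
        by rewrite negb_or -leqNgt => /andP[].
      by rewrite sum_nat_const leq_mul2r Ir orbT.
    by have := cardsID (cross i) (Q (w i)); lia.
  have := ok1 i; rewrite /bad1 -leqNgt => Q_ge.
  apply: leq_trans (valP i) _; apply: leq_trans (leq_mul (leqnn _) Q_ge) _.
  rewrite -/K2; apply: leq_trans (leq_mul (leqnn _) (leq_mul (leqnn _) Q_half)) _.
  by apply: eq_leq; ring.
- move=> i j ij; rewrite -setI_eq0; apply/set0Pn => -[x /setIP[]].
  move=> /mem_core[xi _ _] /mem_core[xj _ _].
  by case/eqP: ij; apply: val_inj; rewrite -xi.
- move=> i j ij a b /mem_core[ai a2 aN] /mem_core[bj b2 bN].
  have := bN i ij; rewrite inE => /constant_on_class/(_ a2) <-.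
  have := ok2 j i ij; rewrite negb_or inE => /andP[/constant_on_class/(_ b2) ww _].
  by rewrite symE -ww symE.
set pi := fun v => insubd i0 (kap v).
have val_pi v : large (kap v) -> val (pi v) = kap v by move=> lv; rewrite val_insubd lv.
set S := [set p | _].
pose small := [set v | ~~ large (kap v)].
have small_le : (N * #|small| <= n)%N.
  have := few_in_small_classes kap [set: V] (N * r).
  set S' := [set x in _ | _]; have -> : S' = small.
    apply/setP => v; rewrite !inE /large -ltnNge cardsT; congr (_ * _ < _)%N.
    by apply: eq_card => u; rewrite !inE.
  rewrite cardsT -/n => le_n; rewrite -(leq_pmul2r r0) mulnAC.
  by rewrite (leq_trans le_n)// mulnC leq_mul2l cardT orbT.
pose S1 := [set p : V * V | p.1 \in small].
pose S1' := [set p : V * V | p.2 \in small].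
pose S2 := [set p : V * V | kap p.1 == kap p.2].
pose S3 := [set p : V * V | p.2 \in cross1 (kap p.1)].
pose D (i j : I) := if bad3 i j (w i) then setX (A' i) (A' j) else set0.
pose S4 := \bigcup_i \bigcup_(j | j != i) D i j.
have S_sub : S \subset S1 :|: S1' :|: S2 :|: S3 :|: S4.
  apply/subsetP => -[u v]; rewrite [_ \in S]inE /= => uvS.
  have [us|uN] := boolP (u \in small).
    by rewrite 4!in_setU [_ \in S1]in_set us.
  have [vs|vN] := boolP (v \in small).
    by rewrite 4!in_setU [_ \in S1']in_set vs orbT.
  have [uv|uv] := eqVneq (kap u) (kap v).
    by rewrite 4!in_setU [_ \in S2]in_set uv eqxx !orbT.
  have [vu|uvN] := boolP (v \in cross1 (kap u)).
    by rewrite 4!in_setU [_ \in S3]in_set vu !orbT.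
  rewrite in_setU; apply/orP; right.
  move: uN vN; rewrite !inE !negbK => /val_pi piu /val_pi piv /=.
  have ij : pi u != pi v by apply: contra uv => /eqP eq_pi; rewrite -piu eq_pi piv.
  apply/bigcupP; exists (pi u) => //; apply/bigcupP; exists (pi v); first by rewrite eq_sym.
  suff wN : bad3 (pi u) (pi v) (w (pi u)).
    by rewrite /D wN inE /A' !inE piu piv !eqxx.
  apply: contraLR uvS; rewrite /bad3 piv (negbTE ij) /= negbK.
  rewrite inE => /constant_on_class/(_ (etrans (w_class _) piv)) wv.
  move: uvN; rewrite inE => /constant_on_class/(_ (etrans (w_class _) piu)) ->.
  by rewrite symE wv symE.
have S1_le : (N * #|S1| <= n * n)%N.
  rewrite (_ : S1 = setX small setT); last by apply/setP => p; rewrite !inE andbT.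
  by rewrite cardsX cardsT mulnA leq_mul2r small_le orbT.
have S1'_le : (N * #|S1'| <= n * n)%N.
  rewrite (_ : S1' = setX setT small); last by apply/setP => p; rewrite !inE.
  by rewrite cardsX cardsT mulnCA leq_mul2l small_le orbT.
have S2_le : (N * #|S2| <= 2 * (n * n))%N.
  rewrite (card_pairs (fun u v => kap u == kap v)).
  apply: (@leq_trans (N * \sum_(u : V) (n %/ N + 1))%N).
    rewrite leq_mul2l; apply/orP; right; apply: leq_sum => u _.
    by apply: leq_trans (A_le (kap u)); apply: eq_leq; apply: eq_card => v;
       rewrite !inE eq_sym.
  rewrite sum_nat_const -/n mulnCA mulnDr muln1 mulnCA leq_mul2l; apply/orP; right.
  by have := leq_trunc_div n N; lia.
have S3_le : (N * #|S3| <= n * n)%N.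
  rewrite (card_pairs (fun u v => v \in cross1 (kap u))) big_distrr -sum_nat_const.
  by apply: leq_sum => u _; apply: leq_trans (cross1_le (kap u)); rewrite cardsE.
have S4_le : (N * #|S4| <= 4 * (n * n))%N.
  apply: leq_trans sum3; rewrite leq_mul2l; apply/orP; right.
  apply: leq_trans (leq_card_bigcup _ _) _; apply: leq_sum => i _.
  apply: leq_trans (leq_card_bigcup _ _) _; apply: leq_sum => j _.
  by rewrite /D; case: (bad3 i j (w i)); rewrite ?cards0// cardsX muln1.
have S_le : (#|S| <= #|S1| + #|S1'| + #|S2| + #|S3| + #|S4|)%N.
  apply: leq_trans (subset_leq_card S_sub) _.
  do 4 (apply: leq_trans (leq_card_setU _ _) _; rewrite leq_add2r).
  by [].
apply: leq_trans (leq_mul (leqnn N) S_le) _.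
rewrite !mulnDr -mulnn; lia.
Qed.
End Model.

(** * Random samples of vertices *)

Lemma ffact_ge n k : (n ^ k * (n - k * k) <= n * n ^_ k)%N.
Proof.
elim: k => [|k IH]; first by rewrite expn0 ffactn0 muln1 mul1n leq_subr.
rewrite ffactnSr mulnA; apply: leq_trans (leq_mul IH (leqnn _)).
rewrite expnSr -!mulnA leq_mul2l; apply/orP; right.
have [lt|ge] := ltnP n (k.+1 * k.+1); first by rewrite (_ : (n - _ = 0)%N) ?muln0//; lia.
nia.
Qed.

(** Sampling without repetition loses only a factor 2 against independent
    sampling when the graph is large compared to the sample. *)
Lemma many_injections n q : (2 * q ^ 2 <= n)%N -> (n ^ q <= 2 * n ^_ q)%N.
Proof.
move=> qn; have [n0|n0] := posnP n.
  by have -> : q = 0%N by move: qn; rewrite n0; case: (q).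
rewrite -(leq_pmul2l n0) mulnCA.
apply: leq_trans (leq_mul (leqnn 2) (ffact_ge n q)).
by rewrite [leqLHS]mulnC mulnCA leq_mul2l; apply/orP; right; rewrite -mulnn in qn; lia.
Qed.

Lemma card_missing (V : finType) (q : nat) (B : {set V}) :
  #|[set f : {ffun 'I_q -> V} | [forall l, f l \notin B]]| = ((#|V| - #|B|) ^ q)%N.
Proof.
rewrite -[in RHS](card_ord q) -(cardsC B) addKn -card_ffun_on.
apply: eq_card => f; rewrite inE; apply/forallP/ffun_onP => fB l; have := fB l.
  by rewrite inE.
by rewrite inE.
Qed.

Lemma few_missing (V : finType) (L m : nat) (B : {set V}) :
  (0 < L)%N -> (#|V| <= L * #|B|)%N ->
  (2 ^ m * (#|V| - #|B|) ^ (L * m) <= #|V| ^ (L * m))%N.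
Proof.
move=> L0 VB; rewrite -(leq_pmul2l (_ : 0 < L ^ (L * m))%N) ?expn_gt0 ?L0//.
rewrite mulnCA -expnMn.
apply: (@leq_trans (2 ^ m * (L.-1 * #|V|) ^ (L * m))%N).
  rewrite leq_mul2l leq_expl ?orbT// mulnBr; case: (L) L0 VB => // k _ VB.
  by rewrite [k.+1.-1]/= mulSn; lia.
by rewrite expnMn mulnA leq_mul// double_pred_expn.
Qed.

(** Each B i is split into s pieces of density at least 1 / (2 s L); a sample that
    meets all pieces has s distinct vertices in each B i, and a union bound over
    the r s pieces controls the samples that miss one. *)
Lemma samples_hit (I V : finType) (B : I -> {set V}) (L r s q : nat) :
  (0 < L)%N -> (0 < r)%N -> (0 < s)%N -> (#|I| <= r)%N ->
  (forall i, (#|V| <= L * #|B i|)%N) ->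
  q = (2 * s * L * (6 * r * s))%N -> (2 * q ^ 2 <= #|V|)%N ->
  (3 * #|[set f in samples q V | [exists i, #|[set v in B i | v \in codom f]| < s]]|
    <= #|samples q V|)%N.
Proof.
move=> L0 r0 s0 Ir VB qE qV; set n := #|V| in VB qV *.
set L' := (2 * s * L)%N in qE; set m := (6 * r * s)%N in qE.
have L'0 : (0 < L')%N by rewrite !muln_gt0 s0 L0.
have m0 : (0 < m)%N by rewrite !muln_gt0 r0 s0.
have samplesE : #|samples q V| = (n ^_ q)%N.
  by rewrite /samples card_inj_ffuns card_ord.
have B_ge i : (s <= #|B i|)%N.
  rewrite -(leq_pmul2l L0); apply: leq_trans (VB i); apply: leq_trans qV.
  have : (L * s <= q)%N by rewrite qE /L'; nia.
  by rewrite -mulnn; nia.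
have [g gP] : exists g : I -> V -> 'I_s, forall i a,
    (#|B i| %/ s <= #|[set v in B i | g i v == a]|)%N.
  have choice i : exists g : {ffun V -> 'I_s}, forall a,
      (#|B i| %/ s <= #|[set v in B i | g v == a]|)%N.
    have [g gP] := split_evenly (B i) s0; exists (finfun g) => a.
    have /andP[+ _] := gP a; move=> /leq_trans; apply; apply: eq_leq.
    by apply: eq_card => v; rewrite !inE ffunE.
  by have [g gP] := fin_all_exists choice; exists g.
pose piece i a := [set v in B i | g i v == a].
pose miss i a := [set f : {ffun 'I_q -> V} | [forall l, f l \notin piece i a]].
have piece_ge i a : (n <= L' * #|piece i a|)%N.
  apply: leq_trans (VB i) _; rewrite /L' -mulnA mulnCA [(2 * _)%N]mulnC -mulnA leq_mul2l.
  apply/orP; right; apply: (@leq_trans (2 * (#|B i| %/ s) * s)%N); last first.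
    by have := gP i a; rewrite -/(piece i a); nia.
  have : (0 < #|B i| %/ s)%N by rewrite divn_gt0.
  by have := ltn_ceil #|B i| s0; nia.
have miss_le i a : (2 ^ m * #|miss i a| <= n ^ q)%N.
  by rewrite card_missing qE few_missing// piece_ge.
set bad := [set f in _ | _].
have bad_sub : bad \subset \bigcup_i \bigcup_a miss i a.
  apply/subsetP => f; rewrite inE => /andP[_ /existsP[i]]; apply: contraLR => f_hits.
  have hit a : exists l, f l \in piece i a.
    apply/existsP; apply: contraNT f_hits; rewrite negb_exists => f_miss.
    by apply/bigcupP; exists i => //; apply/bigcupP; exists a => //; rewrite inE.
  have [l lP] := fin_all_exists hit.
  rewrite -leqNgt -[leqLHS]card_ord -(card_imset predT (_ : injective (fun a => f (l a)))).
    apply/subset_leq_card/subsetP => _ /imsetP[a _ ->].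
    by rewrite inE codom_f andbT; have := lP a; rewrite inE => /andP[].
  move=> a b fab; have := lP a; have := lP b; rewrite !inE fab.
  by move=> /andP[_ /eqP gb] /andP[_ /eqP ga]; apply: etrans gb.
have bad_le : (2 ^ m * #|bad| <= r * s * n ^ q)%N.
  apply: leq_trans (leq_mul (leqnn _) (subset_leq_card bad_sub)) _.
  apply: leq_trans (leq_mul (leqnn _) (leq_card_bigcup _ _)) _.
  rewrite big_distrr /=; apply: (@leq_trans (\sum_(i : I) s * n ^ q)%N).
    apply: leq_sum => i _.
    apply: leq_trans (leq_mul (leqnn _) (leq_card_bigcup _ _)) _.
    rewrite big_distrr /= -[s in leqRHS]card_ord -sum_nat_const.
    exact: leq_sum.
  by rewrite sum_nat_const mulnA leq_mul2r leq_mul2r Ir !orbT.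
have : (r * s * (6 * #|bad|) <= r * s * n ^ q)%N.
  apply: leq_trans bad_le; have := ltn_expl m (isT : 1 < 2)%N; rewrite /m.
  by move: (2 ^ _)%N #|bad| => x y; nia.
rewrite leq_pmul2l ?muln_gt0 ?r0// => bad6; rewrite samplesE.
by have := many_injections qV; lia.
Qed.

(** * Hereditary properties *)

Section Pullback.
Variables (V W : finType) (G : simple_graph V) (f : W -> V).

Definition pullback_adj : rel W := fun u v => G (f u) (f v).

Lemma pullback_sym : symmetric pullback_adj.
Proof. by move=> u v; apply: adj_sym. Qed.

Lemma pullback_irrefl : irreflexive pullback_adj.
Proof. by move=> u; apply: adj_irrefl. Qed.

Definition pullback := SimpleGraph pullback_sym pullback_irrefl.
End Pullback.

Section BlowUp.
Variables (V W : finType) (R : loop_graph W) (pi : V -> W).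

Definition blow_up_adj : rel V := fun u v => (u != v) && R (pi u) (pi v).

Lemma blow_up_sym : symmetric blow_up_adj.
Proof. by move=> u v; rewrite /blow_up_adj eq_sym (ladj_sym R). Qed.

Lemma blow_up_irrefl : irreflexive blow_up_adj.
Proof. by move=> u; rewrite /blow_up_adj eqxx. Qed.

Definition blow_up := SimpleGraph blow_up_sym blow_up_irrefl.
End BlowUp.

Lemma hereditary_embedding (P : graph_family) : hereditary P ->
  forall (V W : finType) (G : simple_graph V) (H : simple_graph W) (f : W -> V),
  injective f -> (forall u v, H u v = G (f u) (f v)) -> P _ G -> P _ H.
Proof.
move=> [isoP indP] V W G H f f_inj HE PG.
pose S := [set f x | x in [set: W]].
apply: isoP (indP _ _ S PG).
have fS x : f x \in S by rewrite imset_f ?inE.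
pose h x : {y | y \in S} := exist _ (f x) (fS x).
have h_inj : injective h by move=> x y /(congr1 val)/f_inj.
have h_bij : bijective h.
  apply: inj_card_bij => //; rewrite card_sig.
  by rewrite (eq_card (B := S)) ?card_imset ?cardsT// => x; rewrite inE.
have [g hK gK] := h_bij; exists g; split; first by exists h.
by move=> u v; rewrite HE -[f _]/(val (h _)) -[f (g v)]/(val (h _)) !gK.
Qed.

(** A smallest vertex set inducing a graph without the property induces a minimal
    forbidden graph. *)
Lemma exists_minimal_forbidden (P : graph_family) : hereditary P ->
  forall (V : finType) (G : simple_graph V), ~ P _ G ->
  exists (W : finType) (H : simple_graph W) (f : W -> V),
  [/\ minimal_forbidden P H, injective f & forall u v, H u v = G (f u) (f v)].
Proof.
move=> herP V G nPG.
pose bad (S : {set V}) := `[< ~ P _ (induced G S) >].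
have [|S /minsetP[/asboolP badS minS]] := ex_minset (P := bad).
  exists setT; apply/asboolP => PT; apply: nPG.
  have inT (v : V) : v \in [set: V] by rewrite inE.
  by apply: (hereditary_embedding herP (f := fun v => exist _ v (inT v))) PT => // u v [].
exists {x | x \in S}, (induced G S), val; split=> //; last exact: val_inj.
split=> // S' S'S; apply: contrapT => badS'.
have inB (x : {y | y \in S'}) : val (val x) \in [set val y | y in S'].
  by apply: imset_f; apply: (valP x).
have B_bad : bad [set val y | y in S'].
  apply/asboolP => PB; apply: badS'.
  apply: (hereditary_embedding herP (f := fun x => exist _ (val (val x)) (inB x))) PB => //.
  by move=> x y /(congr1 val)/= /val_inj/val_inj.
have BS : [set val y | y in S'] \subset S.
  by apply/subsetP => _ /imsetP[y _ ->]; apply: (valP y).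
have := minS _ B_bad BS => eqS; move: S'S; rewrite properE => /andP[_ /negP]; apply.
apply/subsetP => x _; have : val x \in [set val y | y in S'] by rewrite eqS (valP x).
by case/imsetP => y yS' /val_inj ->.
Qed.

(** A minimal forbidden graph induced in the blow-up of R would map to R by pi. *)
Lemma blow_up_property (P : graph_family) : hereditary P ->
  forall (V W : finType) (R : loop_graph W) (pi : V -> W),
  ~ (exists m, maps_to (minimal_forbidden P) R m) -> P _ (blow_up R pi).
Proof.
move=> herP V W R pi noR; apply: contrapT => /(exists_minimal_forbidden herP).
case=> U [H [f [minH f_inj HE]]]; apply: noR; exists #|U|, U, H; split=> //.
exists (pi \o f); split=> u v /=; rewrite HE /= /blow_up_adj.
  by case/andP.
by move=> uv; rewrite (inj_eq f_inj) uv.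
Qed.

Lemma psi2_bound (F : graph_family) (K : realType) (r : K) (W : finType)
    (R : loop_graph W) : in_Hr F r R ->
  exists (V : finType) (H : simple_graph V),
    [/\ F _ H, ind_hom H R & (#|V| <= psi2 F r)%N].
Proof.
move=> HR; have [[V [H [FH HtoR cardV]]] _] := min_order_attained HR.2.
exists V, H; split=> //; rewrite cardV /psi2; case: asboolP => [exR|[]]; last by exists W, R.
by have [_ ->//] := max_min_order_attained exR; exists W, R.
Qed.

(** Vertices of H that are mapped to i receive distinct vertices of Y i, the u-th
    vertex of H taking the u-th element. *)
Lemma embed_in_cores (V W U : finType) (G : simple_graph V) (R : loop_graph W)
    (H : simple_graph U) (Y : W -> {set V}) :
  ind_hom H R -> (forall i, #|U| <= #|Y i|)%N ->
  (forall i, monochromatic G (R i i) (Y i)) ->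
  (forall i j, i != j -> [disjoint Y i & Y j]) ->
  (forall i j, i != j -> {in Y i & Y j, forall a b, G a b = R i j}) ->
  exists f : U -> V, [/\ injective f, forall u, exists i, f u \in Y i &
    forall u v, H u v = G (f u) (f v)].
Proof.
move=> [h [h_edge h_non]] UY clY disY crossY.
have [f fP] : exists f : U -> V, forall u, f u \in Y (h u) /\
    index (f u) (enum (Y (h u))) = enum_rank u.
  apply: (@fin_all_exists U (fun=> V) (fun u v => v \in Y (h u) /\
    index v (enum (Y (h u))) = enum_rank u)) => u.
  have rank_lt : (enum_rank u < size (enum (Y (h u))))%N.
    by rewrite -cardE (leq_trans _ (UY (h u))).
  have [v0 _] : exists v, v \in Y (h u).
    by apply/set0Pn; rewrite -card_gt0 cardE (leq_trans _ rank_lt).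
  exists (nth v0 (enum (Y (h u))) (enum_rank u)); split.
    by rewrite -mem_enum mem_nth.
  by rewrite index_uniq ?enum_uniq.
have f_inj : injective f.
  move=> u v fuv; have [fu ru] := fP u; have [fv rv] := fP v.
  have huv : h u = h v.
    apply/eqP; apply: contraTT fv => /disY/disjointFr; rewrite -fuv => ->//.
  by apply/enum_rank_inj/val_inj; rewrite /= -ru -rv huv fuv.
exists f; split=> // [u|u v]; first by exists (h u); case: (fP u).
have [<-|uv] := eqVneq u v; first by rewrite !adj_irrefl.
have -> : G (f u) (f v) = R (h u) (h v).
  have [fu _] := fP u; have [fv _] := fP v.
  have [huv|huv] := eqVneq (h u) (h v); last exact: crossY.
  by rewrite -huv; apply: clY; rewrite ?(inj_eq f_inj)// huv.
case: (boolP (H u v)) => Huv; first by rewrite h_edge.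
by rewrite (negbTE (h_non _ _ uv Huv)).
Qed.

(** * Testing by inspecting a random sample *)

(** The answers are accumulated in the continuation dec, so that the tree has the
    shape of the list of queries. *)
Fixpoint query_all (k : nat) (l : seq ('I_k * 'I_k)) (dec : seq bool -> bool) :
    query_alg k :=
  if l is p :: l'
  then Query p.1 p.2 (fun b => query_all l' (fun s => dec (b :: s)))
  else Output k (dec [::]).

Lemma accept_query_all (R : realType) (k : nat) (e : rel 'I_k) l dec :
  accept_prob R e (query_all l dec) = (dec [seq e p.1 p.2 | p <- l])%:R.
Proof. by elim: l dec => //= p l IH dec; rewrite IH. Qed.

Definition decision_tree (k : nat) (D : rel 'I_k -> bool) : query_alg k :=
  let pairs := enum {: 'I_k * 'I_k} in
  query_all pairs (fun s => D (fun i j => nth false s (index (i, j) pairs))).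

Lemma accept_decision_tree (R : realType) (k : nat) (D : rel 'I_k -> bool) e :
  accept_prob R e (decision_tree D) = (D e)%:R.
Proof.
rewrite accept_query_all; congr (nat_of_bool (D _))%:R.
apply/funext => i; apply/funext => j; set pairs := enum _.
have ij : (i, j) \in pairs by rewrite mem_enum.
by rewrite (nth_map (i, j)) ?index_mem ?nth_index.
Qed.

(** The answers to the queries form a bare relation, while P speaks of graphs. *)
Definition has_property (P : graph_family) (k : nat) (e : rel 'I_k) : bool :=
  `[< exists G : simple_graph 'I_k, (forall i j, G i j = e i j) /\ P _ G >].

Lemma has_property_pullback (P : graph_family) : hereditary P ->
  forall (k : nat) (V : finType) (G : simple_graph V) (s : 'I_k -> V),
  has_property P (fun i j => G (s i) (s j)) <-> P _ (pullback G s).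
Proof.
move=> herP k V G s; split=> [/asboolP[G' [G'E PG']]|PG].
  by apply: (hereditary_embedding herP (f := id)) PG' => // i j; rewrite G'E.
by apply/asboolP; exists (pullback G s).
Qed.

Section SamplingTester.
Variables (P : graph_family) (k : nat -> nat).
Hypotheses (herP : hereditary P) (k_le : forall n, (k n <= n)%N).

Definition sampling_tester : tester :=
  Tester k_le (fun n => decision_tree (@has_property P (k n))).

Definition good_samples (V : finType) (G : simple_graph V) :=
  [set s in samples (k #|V|) V | `[< P (pullback G s) >]].

Lemma sampling_tester_accept (R : realType) (V : finType) (G : simple_graph V) :
  tester_accept_prob R sampling_tester G =
  #|good_samples G|%:R / #|samples (k #|V|) V|%:R.
Proof.
rewrite /tester_accept_prob /=; congr (_ / _).
under eq_bigr => s _ do rewrite accept_decision_tree.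
rewrite -natr_sum -big_mkcondr sum1dep_card; congr _%:R; apply: eq_card => s.
rewrite !inE; congr (_ && _); apply/idP/asboolP.
  by move/(has_property_pullback herP).
by move/(has_property_pullback herP).
Qed.

(** By heredity the error is one-sided, so only far graphs need a bound. *)
Lemma sampling_tester_correct (R : realType) (A : graph_family) (eps : R) :
  (forall (V : finType) (G : simple_graph V), A _ G -> eps_far P eps G ->
     (3 * #|good_samples G| <= #|samples (k #|V|) V|)%N) ->
  is_eps_tester A P eps sampling_tester.
Proof.
move=> farP V G AG; rewrite sampling_tester_accept.
have S0 : (0 < #|samples (k #|V|) V|)%N.
  by rewrite card_inj_ffuns card_ord ffact_gt0.
split=> [PG|/(farP V G AG) far3].
  rewrite (_ : good_samples G = samples (k #|V|) V).
    by rewrite divff ?pnatr_eq0 -?lt0n//; lra.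
  apply/setP => s; rewrite inE; apply: andb_idr; rewrite inE => /injectiveP s_inj.
  by apply/asboolP; apply: (hereditary_embedding herP s_inj) PG.
have : #|good_samples G|%:R / #|samples (k #|V|) V|%:R <= 1 / 3 :> R.
  by rewrite ler_pdivrMr ?ltr0n// mulrAC ler_pdivlMr// mul1r -natrM ler_nat mulnC.
by lra.
Qed.
End SamplingTester.

Lemma full_sample_far (R : realType) (P : graph_family) (eps : R) (V : finType)
    (G : simple_graph V) (s : 'I_#|V| -> V) :
  hereditary P -> 0 < eps -> eps_far P eps G -> injective s -> ~ P _ (pullback G s).
Proof.
move=> herP eps0 far s_inj Ps.
have [t tK sK] : bijective s by apply: inj_card_bij; rewrite ?card_ord.
have PG : P _ G.
  apply: (hereditary_embedding herP (can_inj sK)) Ps => u v.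
  by rewrite /= /pullback_adj !sK.
have := far G PG; rewrite (_ : changed_pairs G G = set0).
  by rewrite cards0 mul0r leNgt eps0.
apply/setP => X; rewrite inE; apply/negbTE/imsetP => -[p].
by rewrite inE eqxx.
Qed.

Lemma changed_pairs_bound (V : finType) (G G' : simple_graph V) (S : {set V * V}) :
  (forall u v, u != v -> (u, v) \notin S -> G u v = G' u v) ->
  (#|changed_pairs G G'| <= #|S|)%N.
Proof.
move=> agree; apply: leq_trans (leq_imset_card (fun p => [set p.1; p.2]) (mem S)).
apply/subset_leq_card/subsetP => _ /imsetP[[u v] /= diff ->].
apply: (imset_f (fun p => [set p.1; p.2]) (x := (u, v))).
move: diff; rewrite inE /=; apply: contraNT => uvS; apply/eqP.
have [<-|uv] := eqVneq u v; first by rewrite !adj_irrefl.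
exact: agree.
Qed.

Section FarGraphs.
Variables (R : realType) (P : graph_family) (eps : R) (c e N : nat).
Variables (V : finType) (G : simple_graph V) (E : rel V) (r : R).
Let psi := psi2 (minimal_forbidden P) r.
Hypotheses (herP : hereditary P) (symE : symmetric E) (cutE : cuttable c E).
Hypothesis EG : forall u v, u != v -> E u v = G u v.
Hypothesis ramsey : forall U : {set V}, (psi ^ e <= #|U|)%N ->
  exists b (Q : {set V}), [/\ Q \subset U, monochromatic E b Q & #|Q| = psi].
Hypotheses (N_gt : 36 < N%:R * eps) (far : eps_far P eps G).
Hypotheses (r_ge : (part_number c N)%:R <= r) (psi_gt0 : (0 < psi)%N).

Definition sample_bound (L p s : nat) := (2 * s * L * (6 * p * s))%N.

(** The loops of the model M depend on the sample, through the type of the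
    homogeneous set found in each core.  Whatever they are, M has at most r
    vertices, and either M maps a small forbidden graph into the sample or its
    blow-up shows that G is close to P. *)
Lemma far_sample_rejected q :
  q = sample_bound (core_ratio c N) (part_number c N) (psi ^ e) ->
  (2 * q ^ 2 <= #|V|)%N ->
  (3 * #|[set s in samples q V | `[< P (pullback G s) >]]| <= #|samples q V|)%N.
Proof.
move=> qE qV.
have N0 : (0 < N)%N by rewrite lt0n; apply: contraTneq N_gt => ->; rewrite mul0r -leNgt ler0n.
have parts0 := part_number_gt0 c N0; have core0 := core_ratio_gt0 c N0.
have s0 : (0 < psi ^ e)%N by rewrite expn_gt0 psi_gt0.
have parts_le : (part_number c N <= q)%N.
  rewrite qE; move: (psi ^ e)%N (core_ratio c N) (part_number c N) s0 core0.
  move=> s L p s0' L0; rewrite (_ : sample_bound _ _ _ = (12 * s * L * s) * p)%N.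
    by rewrite leq_pmull// !muln_gt0 s0' L0.
  by rewrite /sample_bound; ring.
have NV : (0 < N <= #|V|)%N.
  rewrite N0 (leq_trans _ qV)//.
  have : (N <= part_number c N)%N.
    by rewrite leq_pmull// expn_gt0 muln_gt0 N0; case: (c).
  rewrite -mulnn; nia.
have [I [pi [w [B [Ile B_ge B_dis B_E bad_le]]]]] := homogeneous_model symE cutE NV.
apply: leq_trans (samples_hit core0 parts0 s0 Ile B_ge qE qV).
rewrite leq_mul2l; apply/orP; right; apply/subset_leq_card/subsetP => s.
rewrite !inE => /andP[s_inj /asboolP Ps]; rewrite s_inj /=; move/injectiveP in s_inj.
apply: contraPT Ps; rewrite negb_exists => /forallP hits Ps.
have [b bP] : exists b : I -> bool, forall i, exists Q : {set V},
    [/\ Q \subset [set v in B i | v \in codom s], monochromatic E (b i) Q & #|Q| = psi].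
  apply: (@fin_all_exists I (fun=> bool) (fun i b => exists Q : {set V},
    [/\ Q \subset [set v in B i | v \in codom s], monochromatic E b Q & #|Q| = psi])) => i.
  by apply: ramsey; have := hits i; rewrite -leqNgt.
have {bP} [Y YP] := fin_all_exists bP.
have YB i : Y i \subset B i.
  by have [sub _ _] := YP i; apply: subset_trans sub _;
     apply/subsetP => v; rewrite inE => /andP[].
pose adjR : rel I := fun i j => if i == j then b i else E (w i) (w j).
have symR : symmetric adjR.
  by move=> i j; rewrite /adjR eq_sym; case: eqP => [->|] //; rewrite symE.
pose M := LoopGraph symR.
have Y_dis i j : i != j -> [disjoint Y i & Y j].
  by move=> /B_dis; apply: disjointW (YB i) (YB j).
have [[m Mm]|noM] := pselect (exists m, maps_to (minimal_forbidden P) M m).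
  have [|U [H [minH HM U_le]]] := @psi2_bound (minimal_forbidden P) R r I M.
    by split; [apply: le_trans r_ge; rewrite ler_nat|exists m].
  have [i|i|||f [f_inj fY HE]] := embed_in_cores (G := G) (Y := Y) HM.
  - by have [_ _ ->] := YP i.
  - have [_ clY _] := YP i; move=> u v uY vY uv; rewrite -EG// clY//.
    by rewrite /= /adjR eqxx.
  - exact: Y_dis.
  - move=> i j ij u v uY vY; rewrite -EG.
      by rewrite /= /adjR (negbTE ij) (B_E i j ij)// (subsetP (YB _)).
    by apply: contraTneq vY => <-; rewrite (disjointFr (Y_dis i j ij) uY).
  have [k sk] : exists k : U -> 'I_q, forall x, s (k x) = f x.
    apply: (@fin_all_exists U (fun=> 'I_q) (fun x l => s l = f x)) => x.
    have [i fi] := fY x; have [/subsetP sub _ _] := YP i.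
    have := sub _ fi; rewrite inE => /andP[_ /codomP[l ->]].
    by exists l.
  apply: minH.1; apply: (hereditary_embedding herP (f := k)) Ps => [x y|u v].
    by move=> kxy; apply: f_inj; rewrite -!sk kxy.
  by rewrite HE /= /pullback_adj !sk.
have := far (blow_up_property herP pi noM).
set S := [set p | _] in bad_le.
have changed_le : (#|changed_pairs G (blow_up M pi)| <= #|S|)%N.
  apply: changed_pairs_bound => u v uv; rewrite inE negb_or negbK /=.
  move=> /andP[piuv /eqP Euv]; rewrite -EG// Euv /= /blow_up_adj uv.
  by rewrite /= /adjR (negbTE piuv).
have V2 : (2 <= #|V|)%N.
  apply: leq_trans qV; rewrite -[2%N]muln1 leq_mul2l expn_gt0.
  by rewrite (leq_trans parts0).
rewrite ler_pdivlMr ?ltr0n ?bin_gt0// => far_le.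
have : N%:R * eps * 'C(#|V|, 2)%:R <= 9 * #|V|%:R ^+ 2.
  rewrite -mulrA (le_trans (ler_wpM2l (ler0n _ _) far_le))// -natrX -!natrM ler_nat.
  by apply: leq_trans bad_le; rewrite leq_mul2l changed_le orbT.
apply/negP; rewrite -ltNge.
(* n ^ 2 <= 2 n (n - 1), so 9 n ^ 2 is at most 36 times the number of pairs. *)
apply: (@le_lt_trans _ _ (36 * 'C(#|V|, 2)%:R)).
  rewrite -natrX -!natrM ler_nat -mulnn.
  have : ('C(#|V|, 2) * 2 = #|V| * #|V|.-1)%N by rewrite bin_ffact ffactnS ffactn1.
  by case: #|V| V2 => // n; rewrite /=; nia.
by rewrite ltr_pM2r// ltr0n bin_gt0.
Qed.
End FarGraphs.

(** * Polynomial bounds *)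

(** A single power of p serves as bound because p > 1 absorbs constants. *)
Definition poly_bounded (f : nat -> nat) :=
  exists b, forall p, (1 < p)%N -> (f p <= p ^ b)%N.

Lemma poly_bounded_id : poly_bounded id.
Proof. by exists 1%N => p _; rewrite expn1. Qed.

Lemma poly_bounded_const k : poly_bounded (fun=> k).
Proof.
exists k => p p1; apply: leq_trans (ltnW (ltn_expl k (isT : 1 < 2)%N)) _.
exact: leq_expl.
Qed.

Lemma poly_boundedM f g : poly_bounded f -> poly_bounded g ->
  poly_bounded (fun p => f p * g p)%N.
Proof.
by move=> [a fa] [b gb]; exists (a + b)%N => p p1; rewrite expnD leq_mul ?fa ?gb.
Qed.

Lemma poly_boundedX f k : poly_bounded f -> poly_bounded (fun p => f p ^ k)%N.
Proof. by move=> [a fa]; exists (a * k)%N => p p1; rewrite expnM leq_expl ?fa. Qed.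

Lemma part_number_poly c f : poly_bounded f -> poly_bounded (fun p => part_number c (f p)).
Proof.
move=> fP; apply: (poly_boundedM _ fP); apply: poly_boundedX.
exact: poly_boundedM (poly_bounded_const c) fP.
Qed.

Lemma core_ratio_poly c f : poly_bounded f -> poly_bounded (fun p => core_ratio c (f p)).
Proof.
move=> fP; have partP := part_number_poly c fP.
have fineP := poly_boundedM (poly_boundedM (poly_bounded_const 24) (poly_boundedX 4 partP)) fP.
apply: (poly_boundedM (poly_boundedM (poly_boundedM (poly_bounded_const 16) fP)
  (poly_boundedX 2 partP))).
exact: poly_boundedX (poly_boundedM (poly_bounded_const c) fineP).
Qed.

(** * Testability of hereditary properties *)

(** Psi vanishes only if the graph without vertices is forbidden; being an
    induced subgraph of every graph, it then rules out all graphs. *)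
Lemma empty_graph_forbidden (K : realType) (P : graph_family) (r : K) :
  hereditary P -> psi2 (minimal_forbidden P) r = 0%N ->
  forall (V : finType) (G : simple_graph V), ~ P _ G.
Proof.
move=> herP psi0 V G PG.
have [W [M HM]] : exists (W : finType) (M : loop_graph W), in_Hr (minimal_forbidden P) r M.
  by move: psi0; rewrite /psi2; case: asboolP.
have [U [H [[nPH _] _]]] := psi2_bound HM; rewrite psi0 leqn0 => /eqP/card0_eq U0.
have no_vertex (u : U) : False by have := U0 u.
apply: nPH.
by apply: (hereditary_embedding herP (f := fun u => False_rect V (no_vertex u))) PG => u;
  case: (no_vertex u).
Qed.

Theorem theorem5p2 (R : realType) (d t D : nat)
    (hd : (0 < d)%N) (ht : (0 < t)%N) (hD : (0 < D)%N) :
  exists C : nat,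
    forall P : graph_family, hereditary P ->
    forall eps : R, 0 < eps -> eps < 1 / 2 ->
    let r := (1 / eps) ^+ C in
    testable_within (@semialgebraic R d t D) P eps
      ((r * (psi2 (minimal_forbidden P) r)%:R) ^+ C).
Proof.
have [c c0 cutP] := semialgebraic_cuttable R d D ht.
have [e ramsey] := large_homogeneous_set c.
have N_poly : poly_bounded (fun p => 37 * p)%N.
  exact: poly_boundedM (poly_bounded_const 37) poly_bounded_id.
have [b1 part_le] := part_number_poly c N_poly.
have [b2 bound_le] : poly_bounded (fun p =>
    288 * (core_ratio c (37 * p) * part_number c (37 * p)) ^ 2)%N.
  apply: (poly_boundedM (poly_bounded_const 288)); apply: poly_boundedX.
  exact: poly_boundedM (core_ratio_poly c N_poly) (part_number_poly c N_poly).
pose C := (2 * b1 + 2 * b2 + 4 * e + 1)%N; exists C.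
move=> P herP eps eps0 eps_lt r; set psi := psi2 _ _.
have inv_gt2 : 2 < 1 / eps by rewrite ltr_pdivlMr//; lra.
have inv_ge1 : 1 <= 1 / eps by lra.
have r_ge1 : 1 <= r by rewrite exprn_ege1.
(* The bound is then 0, and indeed no query is needed: P is empty. *)
have [psi0|psi_gt0] := posnP psi.
  have noP := empty_graph_forbidden herP psi0.
  exists (sampling_tester P (leq0n)); split=> [n|].
    by rewrite /= exprn_ge0// mulr_ge0 ?ler0n// (le_trans ler01).
  apply: sampling_tester_correct => // V G _ _.
  rewrite (_ : good_samples _ _ _ = set0) ?cards0//.
  by apply/setP => s; rewrite !inE; apply/andP => -[_ /asboolP]; apply: noP.
(* Since eps < 1/2, the integer p above 1/eps is at most (1/eps) ^ 2. *)
pose p := (Num.truncn (1 / eps)).+1.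
have p_gt : 1 / eps < p%:R by rewrite truncnS_gt.
have p1 : (1 < p)%N.
  by rewrite -(ltr_nat R); lra.
have p_le : p%:R <= (1 / eps) ^+ 2.
  have : (Num.truncn (1 / eps))%:R <= 1 / eps by rewrite truncn_le; lra.
  by rewrite /p -natr1; move: inv_gt2; set x := 1 / eps; nra.
have p_pow b m : (2 * b <= m)%N -> (p ^ b)%:R <= (1 / eps) ^+ m.
  move=> bm; apply: (@le_trans _ _ ((1 / eps) ^+ (2 * b))); last exact: ler_weXn2l.
  by rewrite exprM natrX lerXn2r ?nnegrE ?ler0n// exprn_ge0// ltW// (lt_trans _ inv_gt2).
(* Any N > 36 / eps would do; see the final count in far_sample_rejected. *)
pose N := (37 * p)%N.
pose q := sample_bound (core_ratio c N) (part_number c N) (psi ^ e).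
(* Small graphs are read completely. *)
pose k n := if (n <= 2 * q ^ 2)%N then n else q.
have k_le n : (k n <= n)%N.
  rewrite /k; case: (leqP n (2 * q ^ 2)) => // /ltnW; apply: leq_trans.
  by rewrite -mulnn; nia.
have k_bound n : (k n <= 2 * q ^ 2)%N.
  by rewrite /k; case: (leqP n (2 * q ^ 2)) => // _; rewrite -mulnn; nia.
exists (sampling_tester P k_le); split=> [n|].
  apply: (@le_trans _ _ (2 * q ^ 2)%:R); first by rewrite ler_nat k_bound.
  have -> : (2 * q ^ 2 = 288 * (core_ratio c N * part_number c N) ^ 2 * psi ^ (4 * e))%N.
    rewrite /q /sample_bound [(4 * e)%N]mulnC expnM.
    by move: (psi ^ e)%N (core_ratio c N) (part_number c N) => s L m; ring.
  rewrite natrM exprMn ler_pM ?ler0n//.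
    apply: (@le_trans _ _ (p ^ b2)%:R); first by rewrite ler_nat bound_le.
    rewrite -exprM; apply: p_pow; rewrite /C; nia.
  by rewrite -natrX ler_nat leq_pexp2l// /C; lia.
apply: sampling_tester_correct => // V G AG far.
have [E [symE EG cutE]] := cutP V G AG.
rewrite /good_samples /k; case: (leqP #|V| (2 * q ^ 2)) => [_|qV].
  rewrite (_ : [set s in _ | _] = set0) ?cards0//.
  apply/setP => s; rewrite !inE; apply/andP => -[/injectiveP s_inj /asboolP].
  exact: full_sample_far far s_inj.
apply: (@far_sample_rejected R P eps c e N V G E r) => //.
- by move=> U; apply: ramsey.
- have : 1 < p%:R * eps by move: p_gt; rewrite ltr_pdivrMr.
  by rewrite natrM; lra.
- apply: (@le_trans _ _ (p ^ b1)%:R); first by rewrite ler_nat part_le.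
  by apply: p_pow; rewrite /C; lia.
- exact: ltnW.
Qed.
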